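(* Let $k$ be an algebraically closed field, let $X$ be a variety over $k$, and let $f: X\dashrightarrow X$ be a dominant rational self-map. Let $K$ be an algebraically closed field extension of $k$ with $\mathrm{tr.d.}_{k}K\geq \dim X$, and let $X_K$, $f_K$ be the base changes of $X$ and $f$ to $K$. Then $(X_K,f_K)$ satisfies the ZDO property, i.e. either $K(X_K)^{f_K}\neq K$, or there is a point $x\in X_K(K)$ whose $f_K$-orbit is well defined and Zariski dense in $X_K$.
   Context: A variety is an irreducible, reduced, separated scheme of finite type over a field. $\mathrm{tr.d.}_kK$ is the transcendence degree of $K$ over $k$. $K(X_K)^{f_K}$ denotes the field of $f_K$-invariant rational functions on $X_K$, i.e. those $\phi\in K(X_K)$ with $\phi\circ f_K=\phi$. The orbit of $x$ under a dominant rational self-map $g$ is well defined if $g^n(x)$ is not in the indeterminacy locus of $g$ for all $n\ge 0$; the orbit is then $O_g(x)=\{g^n(x)\mid n\ge 0\}$. *)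

(* Defs.v *)
From mathcomp Require Import all_boot all_order all_algebra.
From mathcomp Require mpoly boolp classical_sets topology.

Set Implicit Arguments.
Unset Strict Implicit.
Unset Printing Implicit Defensive.

Import GRing.Theory.
Local Open Scope ring_scope.

(* In a module because the notations of mpoly and topology clash. *)
Module Trdeg.
Import mpoly.

Definition alg_indep (k K : fieldType) (iota : k -> K)
    (n : nat) (t : 'I_n -> K) : Prop :=
  forall q : {mpoly k[n]}, mmap iota t q = 0 -> q = 0.

Definition trdeg_ge (k K : fieldType) (iota : k -> K) (n : nat) : Prop :=
  exists t : 'I_n -> K, alg_indep iota t.

End Trdeg.
Import Trdeg.

Import boolp classical_sets topology.
Local Open Scope classical_set_scope.

Record opens (X : topologicalType) := Opens {
  oset :> set X;
  opensP : open oset }.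

Definition fullO (X : topologicalType) : opens X := Opens openT.

Definition meetO (X : topologicalType) (U V : opens X) : opens X :=
  Opens (openI (opensP U) (opensP V)).

Definition irreducible_set (X : topologicalType) (Z : set X) : Prop :=
  Z !=set0 /\
  forall A B : set X, closed A -> closed B ->
    Z `<=` A `|` B -> Z `<=` A \/ Z `<=` B.

(* dim X >= n for the Krull dimension: there is a chain
   Z 0 < Z 1 < ... < Z n of irreducible closed subsets. *)
Definition krull_dim_ge (X : topologicalType) (n : nat) : Prop :=
  exists Z : nat -> set X,
    (forall i, (i <= n)%N -> closed (Z i) /\ irreducible_set (Z i)) /\
    (forall i, (i < n)%N -> Z i `<` Z i.+1).

(* Rings of sections may be zero, hence comPzRingType. *)
Definition invertible (R : comPzRingType) (s : R) : Prop :=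
  exists t : R, s * t = 1.

Definition prime_ideal (R : comPzRingType) (P : set R) : Prop :=
  [/\ P 0,
      forall a b, P a -> P b -> P (a + b),
      forall a b, P b -> P (a * b),
      ~ P 1 &
      forall a b, P (a * b) -> P a \/ P b].

(* R is generated, as an algebra with structure map alpha : k -> R, by
   finitely many elements. *)
Definition finitely_generated (k R : comPzRingType) (alpha : k -> R) : Prop :=
  exists (n : nat) (a : 'I_n -> R), forall B : set R,
    (forall c, B (alpha c)) -> (forall i, B (a i)) ->
    (forall x y, B x -> B y -> B (x + y)) ->
    (forall x y, B x -> B y -> B (x * y)) ->
    forall x, B x.

Definition lin_indep (k : fieldType) (R : comPzRingType) (alpha : k -> R)
    (n : nat) (a : 'I_n -> R) : Prop :=
  forall c : 'I_n -> k, \sum_(i < n) alpha (c i) * a i = 0 ->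
    forall i, c i = 0.

(* The map A (x)_k B -> C, a (x) b |-> u a * v b, is bijective.  As k is a
   field, every tensor is a sum of a_i (x) b_i with the a_i linearly
   independent over k, and such a sum vanishes iff all the b_i do. *)
Definition is_tensor (k : fieldType) (A B C : comPzRingType)
    (alpha : k -> A) (u : A -> C) (v : B -> C) : Prop :=
  (forall c : C, exists (n : nat) (a : 'I_n -> A) (b : 'I_n -> B),
     c = \sum_(i < n) u (a i) * v (b i)) /\
  (forall (n : nat) (a : 'I_n -> A) (b : 'I_n -> B), lin_indep alpha a ->
     \sum_(i < n) u (a i) * v (b i) = 0 -> forall i, b i = 0).

(* dim X <= tr.d._k K *)
Definition dim_le_trdeg (X : topologicalType) (k K : fieldType)
    (iota : k -> K) : Prop :=
  forall n, krull_dim_ge X n -> trdeg_ge iota n.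

Record ringedSpace := RingedSpace {
  rs_top :> topologicalType;
  O : opens rs_top -> comPzRingType;
  res : forall U V : opens rs_top, V `<=` U -> {rmorphism O U -> O V};
  res_id : forall (U : opens rs_top) (h : U `<=` U) (s : O U), res h s = s;
  res_comp : forall (U V W : opens rs_top) (hV : V `<=` U) (hW : W `<=` V)
    (hU : W `<=` U) (s : O U), res hW (res hV s) = res hU s;
  sheaf_sep : forall (U : opens rs_top) (I : Type) (V : I -> opens rs_top)
    (hV : forall i, V i `<=` U), U `<=` \bigcup_i V i ->
    forall s t : O U, (forall i, res (hV i) s = res (hV i) t) -> s = t;
  sheaf_glue : forall (U : opens rs_top) (I : Type) (V : I -> opens rs_top)
    (hV : forall i, V i `<=` U), U `<=` \bigcup_i V i ->
    forall s : (forall i, O (V i)),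
    (forall i j (W : opens rs_top) (hi : W `<=` V i) (hj : W `<=` V j),
       res hi (s i) = res hj (s j)) ->
    exists t : O U, forall i, res (hV i) t = s i }.

Arguments O {r} _.
Arguments res {r U V} _.

(* The germ of s at x is a unit of the stalk at x. *)
Definition inv_at (X : ringedSpace) (U : opens X) (s : O U) (x : X) : Prop :=
  exists (V : opens X) (h : V `<=` U), oset V x /\ invertible (res h s).

(* Every stalk is a local ring: it is nonzero and its nonunits are closed
   under addition. *)
Definition locally_ringed (X : ringedSpace) : Prop :=
  (forall (U : opens X) (x : X), oset U x -> (1 : O U) <> 0) /\
  (forall (U : opens X) (x : X) (s t : O U), oset U x ->
     inv_at (s + t) x -> inv_at s x \/ inv_at t x).

Lemma open_inv_at (X : ringedSpace) (U : opens X) (s : O U) :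
  open [set x | inv_at s x].
Proof.
rewrite openE => x [V [h [Vx Vs]]]; rewrite /interior nbhsE.
by exists V; [split=> //; exact: opensP | move=> y Vy; exists V, h].
Qed.

(* The basic open subset D(s) of U. *)
Definition basicO (X : ringedSpace) (U : opens X) (s : O U) : opens X :=
  Opens (open_inv_at s).

Lemma basicO_sub (X : ringedSpace) (U : opens X) (s : O U) :
  basicO s `<=` U.
Proof. by move=> x [V [h [Vx _]]]; exact: h. Qed.

(* The canonical morphism U -> Spec O(U) is an isomorphism: on points it sends
   x to the prime of sections that are not invertible at x; it is bijective,
   it is a homeomorphism (the D(s) form a basis of U), and O(D(s)) is the
   localization O(U)[1/s]. *)
Definition affine (X : ringedSpace) (U : opens X) : Prop :=
  [/\ forall P : set (O U), prime_ideal P ->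
        exists! x : X, oset U x /\ P = [set s : O U | ~ inv_at s x],
      forall (V : opens X) (x : X), oset V x -> oset U x ->
        exists s : O U, oset (basicO s) x /\ basicO s `<=` V,
      forall s a : O U, res (@basicO_sub X U s) a = 0 ->
        exists n, s ^+ n * a = 0 &
      forall (s : O U) (t : O (basicO s)), exists (n : nat) (a : O U),
        t * res (@basicO_sub X U s) s ^+ n = res (@basicO_sub X U s) a].

(* The structure morphism X -> Spec k is given by k -> O(X). *)
Record scheme (k : fieldType) := Scheme {
  sch_rs :> ringedSpace;
  sch_local : locally_ringed sch_rs;
  sch_affine : forall x : sch_rs, exists U : opens sch_rs, oset U x /\ affine U;
  sch_str : {rmorphism k -> O (fullO sch_rs)} }.

Definition scal (k : fieldType) (X : scheme k) (U : opens X) (c : k) : O U :=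
  res (@subsetT X U : U `<=` fullO X) (sch_str X c).

Section Morphisms.
Variables (k k' : fieldType) (phi : {rmorphism k -> k'}).
Variables (X : scheme k') (Y : scheme k).

(* Morphisms of locally ringed spaces from the open subspace U of X to Y, lying
   over Spec k' -> Spec k.  The values of mor_fun outside U are irrelevant. *)
Record mor (U : opens X) := Mor {
  mor_fun :> X -> Y;
  mor_cont : forall V : opens Y, open (U `&` mor_fun @^-1` V);
  pre := fun V : opens Y => Opens (mor_cont V);
  pull : forall V : opens Y, {rmorphism O V -> O (pre V)};
  pull_res : forall (V V' : opens Y) (h : V' `<=` V)
    (h' : pre V' `<=` pre V) (s : O V),
    pull V' (res h s) = res h' (pull V s);
  pull_local : forall (V : opens Y) (s : O V) (x : X),
    oset (pre V) x -> inv_at (pull V s) x -> inv_at s (mor_fun x);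
  pull_scal : forall (V : opens Y) (c : k),
    pull V (scal V c) = scal (pre V) (phi c) }.

(* Equality of morphisms, possibly with different domains, on W. *)
Definition mor_agree (W U U' : opens X) (g : mor U) (g' : mor U') : Prop :=
  (forall x, oset W x -> g x = g' x) /\
  (forall (V : opens Y) (s : O V) (W' : opens X)
     (h : W' `<=` pre g V) (h' : W' `<=` pre g' V), W' `<=` W ->
     res h (pull g V s) = res h' (pull g' V s)).

End Morphisms.

(* P = X x_k Y, as in the usual construction of fibre products: over affine
   opens U of X and V of Y it is Spec (O(U) (x)_k O(V)). *)
Definition is_product (k : fieldType) (X Y P : scheme k)
    (p : mor idfun X (fullO P)) (q : mor idfun Y (fullO P)) : Prop :=
  forall (U : opens X) (V : opens Y), affine U -> affine V ->
    let W := meetO (pre p U) (pre q V) in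
    affine W /\
    is_tensor (scal U)
      (fun a : O U => res (@subIsetl _ (pre p U) (pre q V) : W `<=` pre p U)
                        (pull p U a))
      (fun b : O V => res (@subIsetr _ (pre p U) (pre q V) : W `<=` pre q V)
                        (pull q V b)).

(* d o g = id, for g : X -> P and d : P -> X *)
Definition is_section (k : fieldType) (X P : scheme k)
    (d : mor idfun X (fullO P)) (g : mor idfun P (fullO X)) : Prop :=
  (forall x, d (g x) = x) /\
  (forall (V : opens X) (s : O V) (W : opens X)
     (h : W `<=` pre g (pre d V)) (h' : W `<=` V),
     res h (pull g (pre d V) (pull d V s)) = res h' s).

(* The diagonal X -> X x_k X has closed image. *)
Definition separated (k : fieldType) (X : scheme k) : Prop :=
  exists (P : scheme k) (p q : mor idfun X (fullO P))
    (delta : mor idfun P (fullO X)),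
    [/\ is_product p q, is_section p delta, is_section q delta &
        closed (range delta)].

Definition reduced (X : ringedSpace) : Prop :=
  forall (U : opens X) (s : O U) (n : nat), s ^+ n = 0 -> s = 0.

Definition finite_type (k : fieldType) (X : scheme k) : Prop :=
  exists (n : nat) (U : 'I_n -> opens X),
    (forall x : X, exists i, oset (U i) x) /\
    (forall i, affine (U i) /\ finitely_generated (scal (U i))).

Definition is_variety (k : fieldType) (X : scheme k) : Prop :=
  [/\ irreducible_set [set: X], reduced X, separated X & finite_type X].

(* A representative of a rational self-map; rational maps are such
   representatives up to ratmap_eq. *)
Record ratmap (k : fieldType) (X : scheme k) := Ratmap {
  dom : opens X;
  dom_dense : dense dom;
  rmap :> mor idfun X dom }.

Section Rational.
Variables (k : fieldType) (X : scheme k).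

Definition ratmap_eq (f g : ratmap X) : Prop :=
  exists W : opens X,
    [/\ dense W, W `<=` dom f, W `<=` dom g & mor_agree W f g].

Definition dominant (f : ratmap X) : Prop := dense (f @` dom f).

Definition indeterminacy (f : ratmap X) : set X :=
  [set x | ~ exists g : ratmap X, ratmap_eq f g /\ oset (dom g) x].

(* f is defined at x with f(x) = y. *)
Definition ratmap_val (f : ratmap X) (x y : X) : Prop :=
  exists g : ratmap X, [/\ ratmap_eq f g, oset (dom g) x & g x = y].

(* The orbit of x is well defined, and u n = f^n(x) for all n. *)
Definition is_orbit (f : ratmap X) (x : X) (u : nat -> X) : Prop :=
  u 0%N = x /\
  forall n, ~ indeterminacy f (u n) /\ ratmap_val f (u n) (u n.+1).

(* A representative of a rational function, up to ratfun_eq.  For integral X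
   the classes form the function field k(X). *)
Record ratfun := Ratfun {
  fdom : opens X;
  fdom_dense : dense fdom;
  fsec : O fdom }.

Definition ratfun_eq (a b : ratfun) : Prop :=
  exists (W : opens X) (ha : W `<=` fdom a) (hb : W `<=` fdom b),
    dense W /\ res ha (fsec a) = res hb (fsec b).

Lemma dense_fullO : dense (fullO X).
Proof. by move=> A A0 _; rewrite setIT. Qed.

Definition ratfun_const (c : k) : ratfun :=
  Ratfun dense_fullO (scal (fullO X) c).

Definition invariant (f : ratmap X) (a : ratfun) : Prop :=
  exists d : dense (pre f (fdom a)),
    ratfun_eq (Ratfun d (pull f (fdom a) (fsec a))) a.

(* k -> kappa(x) is an isomorphism, i.e. x is a k-point. *)
Definition rational_point (x : X) : Prop :=
  forall (U : opens X) (s : O U), oset U x ->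
    exists c : k, ~ inv_at (s - scal U c) x.

(* First alternative: k(X)^f <> k. *)
Definition ZDO (f : ratmap X) : Prop :=
  (exists a : ratfun,
     invariant f a /\ ~ exists c : k, ratfun_eq a (ratfun_const c)) \/
  (exists (x : X) (u : nat -> X),
     [/\ rational_point x, is_orbit f x u & dense (range u)]).

End Rational.

Section BaseChange.
Variables (k K : fieldType) (iota : {rmorphism k -> K}).
Variables (X : scheme k) (XK : scheme K).

(* XK = X x_k Spec K with projection p, as in the usual construction: over
   each affine open U of X it is Spec (O(U) (x)_k K). *)
Definition is_base_change (p : mor iota X (fullO XK)) : Prop :=
  forall U : opens X, affine U ->
    affine (pre p U) /\
    is_tensor (scal U) (pull p U) (fun c : K => scal (pre p U) c).

(* fK is defined on the preimage of dom f, and p o fK = f o p there. *)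
Definition is_base_change_map (p : mor iota X (fullO XK))
    (f : ratmap X) (fK : ratmap XK) : Prop :=
  [/\ dom fK = pre p (dom f),
      forall x, oset (dom fK) x -> p (fK x) = f (p x) &
      forall (V : opens X) (s : O V) (W : opens XK)
        (h : W `<=` pre fK (pre p V)) (h' : W `<=` pre p (pre f V)),
        res h (pull fK (pre p V) (pull p V s)) =
        res h' (pull p (pre f V) (pull f V s))].

End BaseChange.

(* Main.v *)
Require Import Defs.
From HB Require Import structures.
From mathcomp Require Import all_boot all_order all_algebra.
From mathcomp Require Import ring.
From mathcomp Require mpoly.
From mathcomp Require Import boolp classical_sets topology.

Set Implicit Arguments.
Unset Strict Implicit.
Unset Printing Implicit Defensive.

(** Let L = k(X), with phi = f^* acting on it.  The dimension hypothesis embeds L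
    into K over k by some sigma: lifting a transcendence basis to a chain of primes
    shows tr.d. L <= dim X.  The homomorphisms a (x) c |-> sigma (phi^n a) c define
    K-points x_n of X_K lying over the generic point of X, with f_K x_n = x_(n+1),
    so the orbit of x_0 is well defined.  If it misses a nonempty open set, then some
    nonzero sum of a_i (x) b_i vanishes at all x_n, that is, the sums of
    sigma (phi^n a_i) b_i over i vanish for all n; the b_i can be taken in L, and a
    Casorati-type elimination then yields a phi-invariant element of L outside k.
    Such an element is a nonconstant invariant function on X, and it remains
    nonconstant on X_K because k is algebraically closed. *)

Import GRing.Theory.
Local Open Scope ring_scope.
Local Open Scope classical_set_scope.

(** * Residue fields and prime ideals *)

(** A [K]-point of [XK] over the generic point of [X] is the same as an embedding of [L] into [K]
    over [k], and [fK] acts on these by precomposition with [phi]; this is where the composites of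
    [sigma] with the iterates of [phi] come from. Such a point maps into every nonempty open set of
    [X], in particular into [dom f], so no point has to be chosen to avoid infinitely many
    indeterminacy loci. The price is an embedding of all of [L]: being finitely generated, [L] is
    algebraic over a rational function field, and [K], being algebraically closed, absorbs the
    algebraic part. The obstacle on the side of [XK] is that neither its irreducibility nor its
    reducedness is at hand. Elements of the tensor product of [O U] and [K] are therefore handled by
    coordinates along a [k]-independent family of [O U], and vanishing is replaced by nilpotence: a
    section over an affine open set that is nowhere invertible is nilpotent. Both the density of
    preimages and the nonconstancy of the invariant function are deduced from that. *)

(** Maps out of fractions, tensors and germs are defined on representatives. Given by its graph [G],
    such a map only needs [G] to be functional and closed under the operations; subtraction also
    covers sums, zero and opposites. *)
Lemma rmorph_of_rel (R S : pzRingType) (G : R -> S -> Prop) :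
  (forall x, exists y, G x y) ->
  (forall x y y', G x y -> G x y' -> y = y') ->
  G 1 1 ->
  (forall x x' y y', G x y -> G x' y' -> G (x - x') (y - y')) ->
  (forall x x' y y', G x y -> G x' y' -> G (x * x') (y * y')) ->
  exists g : {rmorphism R -> S}, forall x, G x (g x).
Proof.
move=> tot fct G1 GB GM; have [g gP] := choice tot.
have gB : zmod_morphism g by move=> x y; apply: fct (gP _) (GB _ _ _ _ _ _).
have gM : monoid_morphism g.
  by split=> [|x y]; [exact: fct (gP _) G1 | apply: fct (gP _) (GM _ _ _ _ _ _)].
pose hB := GRing.isZmodMorphism.Build R S g gB.
pose hM := GRing.isMonoidMorphism.Build R S g gM.
by exists (HB.pack g hB hM : {rmorphism R -> S}).
Qed.

Section ResidueField.
Local Open Scope quotient_scope.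
Variables (A : comPzRingType) (P : set A) (PP : prime_ideal P).

Let P0 : P 0. Proof. by case: PP. Qed.
Let PD a b : P a -> P b -> P (a + b). Proof. by case: PP => _ + _ _ _; exact. Qed.
Let PM a b : P b -> P (a * b). Proof. by case: PP => _ _ + _ _; exact. Qed.
Let P1 : ~ P 1. Proof. by case: PP. Qed.
Let Pp a b : P (a * b) -> P a \/ P b.
Proof. by case: PP => _ _ _ _; exact. Qed.
Let PN a : P a -> P (- a). Proof. by rewrite -mulN1r; exact: PM. Qed.

(** The fraction field of [A/P] is built in one step: pairs with denominator outside [P], identified
    when the cross difference lies in [P]. The [asbool] makes both conditions boolean, as subtypes
    and [{eq_quot _}] require. *)
Record rfrac := RFrac { rnd : A * A; _ : ~~ `[< P rnd.2 >] }.
HB.instance Definition _ := [isSub for rnd].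
HB.instance Definition _ := gen_eqMixin rfrac.
HB.instance Definition _ := gen_choiceMixin rfrac.

Let num (x : rfrac) := (rnd x).1.
Let den (x : rfrac) := (rnd x).2.
Let denP x : ~ P (den x). Proof. by case: x => z h; apply: (elimN (asboolP _)). Qed.
Let denM a b : ~ P a -> ~ P b -> ~ P (a * b).
Proof. by move=> ha hb /Pp []. Qed.

Let mk a b (h : ~ P b) : rfrac := @RFrac (a, b) (introN (asboolP _) h).

Definition rfrac_equiv (x y : rfrac) := `[< P (num x * den y - num y * den x) >].

Lemma rfrac_refl : reflexive rfrac_equiv.
Proof. by move=> x; apply/asboolP; rewrite subrr. Qed.
Lemma rfrac_sym : symmetric rfrac_equiv.
Proof. by move=> x y; apply: asbool_equiv_eq; split=> h; rewrite -opprB; exact: PN. Qed.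
Lemma rfrac_trans : transitive rfrac_equiv.
Proof.
move=> y x z /asboolP xy /asboolP yz; apply/asboolP.
have : P (den y * (num x * den z - num z * den x)).
  rewrite (_ : _ * _ = den z * (num x * den y - num y * den x)
                     + den x * (num y * den z - num z * den y)); last by ring.
  by apply: PD; apply: PM.
by case/Pp => // /denP.
Qed.
Canonical rfrac_equivRel :=
  EquivRel rfrac_equiv rfrac_refl rfrac_sym rfrac_trans.

Definition resfield := {eq_quot rfrac_equiv}.
HB.instance Definition _ : EqQuotient _ rfrac_equiv resfield :=
  EqQuotient.on resfield.
HB.instance Definition _ := Choice.on resfield.

Let fr a b (h : ~ P b) : resfield := \pi_resfield (mk a h).

Let frE a b c d (hb : ~ P b) (hd : ~ P d) :
  fr a hb = fr c hd <-> P (a * d - c * b).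
Proof.
by split=> [/eqmodP/asboolP|h] //; apply/eqmodP; apply/asboolP.
Qed.

Let frP (x : resfield) : exists a b (h : ~ P b), x = fr a h.
Proof.
elim/quotW: x => -[[a b] h]; exists a, b, (elimN (asboolP _) h).
by rewrite /fr; congr (\pi_resfield _); apply: val_inj.
Qed.

Let nm (x : resfield) := num (repr x).
Let dn (x : resfield) := den (repr x).
Let dnP x : ~ P (dn x). Proof. exact: denP. Qed.
Let reprfr x : x = fr (nm x) (@dnP x).
Proof.
rewrite -[LHS]reprK /fr; congr (\pi_resfield _); apply: val_inj => /=.
by rewrite /nm /dn /num /den; case: (rnd _).
Qed.
Let reprE a b (h : ~ P b) : P (a * dn (fr a h) - nm (fr a h) * b).
Proof. by apply/(frE _ _ h (@dnP (fr a h))); exact: reprfr. Qed.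

Definition rf_zero : resfield := fr 0 P1.
Definition rf_one : resfield := fr 1 P1.
Definition rf_opp x : resfield := fr (- nm x) (@dnP x).
Definition rf_add x y : resfield :=
  fr (nm x * dn y + nm y * dn x) (denM (@dnP x) (@dnP y)).
Definition rf_mul x y : resfield := fr (nm x * nm y) (denM (@dnP x) (@dnP y)).
Definition rf_inv x : resfield :=
  match pselect (P (nm x)) with
  | left _ => rf_zero
  | right h => fr (dn x) h
  end.

Let oppE a b (h : ~ P b) : rf_opp (fr a h) = fr (- a) h.
Proof.
apply/frE; rewrite (_ : _ - _ = a * dn (fr a h) - nm (fr a h) * b); last by ring.
exact: reprE.
Qed.

Let addE a b c d (h : ~ P b) (h' : ~ P d) :
  rf_add (fr a h) (fr c h') = fr (a * d + c * b) (denM h h').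
Proof.
apply/frE; set x := fr a h; set y := fr c h'.
rewrite (_ : _ - _ = - (d * dn y) * (a * dn x - nm x * b) +
   - (b * dn x) * (c * dn y - nm y * d)); last by ring.
by apply: PD; apply: PM; exact: reprE.
Qed.

Let mulE a b c d (h : ~ P b) (h' : ~ P d) :
  rf_mul (fr a h) (fr c h') = fr (a * c) (denM h h').
Proof.
apply/frE; set x := fr a h; set y := fr c h'.
rewrite (_ : _ - _ = - (nm y * d) * (a * dn x - nm x * b) +
   - (a * dn x) * (c * dn y - nm y * d)); last by ring.
by apply: PD; apply: PM; exact: reprE.
Qed.

Let fr_eq a b c d (hb : ~ P b) (hd : ~ P d) : a * d = c * b -> fr a hb = fr c hd.
Proof. by move=> e; apply/frE; rewrite e subrr. Qed.

Lemma rf_addA : associative rf_add.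
Proof.
move=> x y z; case: (frP x) (frP y) (frP z) => a [b [h ->]] [c [d [h' ->]]].
by case=> e [g [h'' ->]]; rewrite !addE; apply: fr_eq; ring.
Qed.
Lemma rf_addC : commutative rf_add.
Proof.
move=> x y; case: (frP x) (frP y) => a [b [h ->]] [c [d [h' ->]]].
by rewrite !addE; apply: fr_eq; ring.
Qed.
Lemma rf_add0 : left_id rf_zero rf_add.
Proof. by move=> x; case: (frP x) => a [b [h ->]]; rewrite addE; apply: fr_eq; ring. Qed.
Lemma rf_addN : left_inverse rf_zero rf_opp rf_add.
Proof.
by move=> x; case: (frP x) => a [b [h ->]]; rewrite oppE addE; apply: fr_eq; ring.
Qed.
HB.instance Definition _ :=
  GRing.isZmodule.Build resfield rf_addA rf_addC rf_add0 rf_addN.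

Lemma rf_mulA : associative rf_mul.
Proof.
move=> x y z; case: (frP x) (frP y) (frP z) => a [b [h ->]] [c [d [h' ->]]].
by case=> e [g [h'' ->]]; rewrite !mulE; apply: fr_eq; ring.
Qed.
Lemma rf_mulC : commutative rf_mul.
Proof.
move=> x y; case: (frP x) (frP y) => a [b [h ->]] [c [d [h' ->]]].
by rewrite !mulE; apply: fr_eq; ring.
Qed.
Lemma rf_mul1 : left_id rf_one rf_mul.
Proof. by move=> x; case: (frP x) => a [b [h ->]]; rewrite mulE; apply: fr_eq; ring. Qed.
Lemma rf_mulD : left_distributive rf_mul rf_add.
Proof.
move=> x y z; case: (frP x) (frP y) (frP z) => a [b [h ->]] [c [d [h' ->]]].
by case=> e [g [h'' ->]]; rewrite !(mulE, addE); apply: fr_eq; ring.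
Qed.
Lemma rf_one_neq0 : rf_one != rf_zero.
Proof. by apply/eqP => /frE; rewrite mul0r subr0 mul1r. Qed.
HB.instance Definition _ := GRing.Zmodule_isComNzRing.Build resfield
  rf_mulA rf_mulC rf_mul1 rf_mulD rf_one_neq0.

Lemma rf_mulV : forall x : resfield, x != rf_zero -> rf_mul (rf_inv x) x = rf_one.
Proof.
move=> x x0; rewrite /rf_inv; case: pselect => h.
  case/negP: x0; apply/eqP; rewrite (reprfr x); apply/frE.
  by rewrite mul0r subr0 mulrC; exact: PM.
by rewrite [X in rf_mul _ X](reprfr x) mulE; apply: fr_eq; ring.
Qed.
Lemma rf_inv0 : rf_inv rf_zero = rf_zero.
Proof.
rewrite /rf_inv; case: pselect => // h; case: h.
have := reprE 0 P1; rewrite mul0r mulr1 sub0r => /PN; by rewrite opprK.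
Qed.
HB.instance Definition _ := GRing.ComNzRing_isField.Build resfield rf_mulV rf_inv0.

Lemma residue_field_subproof : exists (F : fieldType) (pr : {rmorphism A -> F}),
  (forall a, pr a = 0 <-> P a) /\
  (forall x, exists a b, pr b <> 0 /\ x = pr a / pr b).
Proof.
pose q a : resfield := fr a P1.
have qB : zmod_morphism q.
  move=> x y; rewrite /q -[RHS]/(rf_add _ (rf_opp _)) oppE addE.
  by apply: fr_eq; ring.
have qM : monoid_morphism q.
  by split=> [//|x y]; rewrite /q -[RHS]/(rf_mul _ _) mulE; apply: fr_eq; ring.
pose hB := GRing.isZmodMorphism.Build A resfield q qB.
pose hM := GRing.isMonoidMorphism.Build A resfield q qM.
have q0 a : q a = 0 <-> P a.
  rewrite -[X in q a = X]/rf_zero; split=> [/frE|h].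
    by rewrite mul0r mulr1 subr0.
  by apply/frE; rewrite mul0r mulr1 subr0.
exists resfield, (HB.pack q hB hM : {rmorphism A -> resfield}); split=> [a|x];
  first exact: q0.
have [a [b [h ->]]] := frP x.
exists a, b => /=.
have nb : q b != 0 by apply/eqP => /q0.
split; first exact/eqP.
apply: (canRL (mulfK nb)); rewrite -[LHS]/(rf_mul _ _) mulE.
by apply: fr_eq; ring.
Qed.

End ResidueField.

Definition frac_onto (A : pzRingType) (F : fieldType) (pr : A -> F) : Prop :=
  forall x, exists a b, pr b <> 0 /\ x = pr a / pr b.

Lemma residue_field (A : comPzRingType) (P : set A) : prime_ideal P ->
  exists (F : fieldType) (pr : {rmorphism A -> F}),
    (forall a, pr a = 0 <-> P a) /\ frac_onto pr.
Proof. exact: residue_field_subproof. Qed.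

Lemma frac_lift (A : comPzRingType) (F M : fieldType) (pr : {rmorphism A -> F})
    (t : {rmorphism A -> M}) :
  frac_onto pr -> (forall a, t a = 0 <-> pr a = 0) ->
  exists t' : {rmorphism F -> M}, forall a, t' (pr a) = t a.
Proof.
move=> onto ker.
pose G (x : F) (y : M) := exists a b, [/\ pr b <> 0, x = pr a / pr b & y = t a / t b].
have tn b : pr b <> 0 -> t b != 0 by move=> h; apply/eqP => /ker.
have Geq a b x y : pr b <> 0 -> G x y -> x = pr a / pr b -> y = t a / t b.
  move=> nb [a' [b' [nb' -> ->]]] /eqP; have /eqP nb2 := nb; have /eqP nb2' := nb'.
  rewrite eqr_div // -!rmorphM -subr_eq0 -rmorphB => /eqP /ker.
  rewrite rmorphB !rmorphM => /eqP; rewrite subr_eq0 => /eqP e.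
  by apply/eqP; rewrite eqr_div ?tn // e.
have [||||| g gP] := @rmorph_of_rel F M G.
- by move=> x; have [a [b [nb e]]] := onto x; exists (t a / t b), a, b.
- move=> x y y' h [a [b [nb e ->]]]; exact: Geq h e.
- by exists 1, 1; rewrite !rmorph1 !divr1; split=> //; apply/eqP; exact: oner_neq0.
- move=> x x' y y' [a [b [nb -> ->]]] [a' [b' [nb' -> ->]]].
  exists (a * b' - a' * b), (b * b'); have /eqP := nb; have /eqP := nb'.
  have := tn _ nb; have := tn _ nb' => h1 h2 h3 h4.
  rewrite !rmorphM !rmorphB !rmorphM; split.
  + by apply/eqP; rewrite mulf_neq0.
  + by field; rewrite h3 h4.
  + by field; rewrite h1 h2.
- move=> x x' y y' [a [b [nb -> ->]]] [a' [b' [nb' -> ->]]].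
  exists (a * a'), (b * b'); have /eqP := nb; have /eqP := nb'.
  have := tn _ nb; have := tn _ nb' => h1 h2 h3 h4.
  rewrite !rmorphM; split.
  + by apply/eqP; rewrite mulf_neq0.
  + by field; rewrite h3 h4.
  + by field; rewrite h1 h2.
exists g => a.
have n1 : pr 1 <> 0 by rewrite rmorph1; apply/eqP; exact: oner_neq0.
by rewrite (Geq a 1 _ _ n1 (gP (pr a))) ?rmorph1 ?divr1.
Qed.

Lemma prime_avoiding (A : comPzRingType) (I S : set A) :
  I 0 -> (forall a b, I a -> I b -> I (a + b)) -> (forall a b, I b -> I (a * b)) ->
  S 1 -> (forall a b, S a -> S b -> S (a * b)) -> (forall a, I a -> S a -> False) ->
  exists P : set A, [/\ prime_ideal P, I `<=` P & forall a, P a -> S a -> False].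
Proof.
move=> I0 ID IM S1 SM IS.
(* The empty set is admitted so that the union of the empty chain is. *)
pose Q (J : set A) := [/\ forall a b, J a -> J b -> J (a + b),
  forall a b, J b -> J (a * b), J !=set0 -> I `<=` J & forall a, J a -> S a -> False].
have [F FQ Ftot|P [[PD PM PI PS] Pmax]] := @Zorn_bigcup A Q.
  split.
  - move=> a b [X FX Xa] [Y FY Yb]; have [XY|YX] := Ftot _ _ FX FY.
    + by exists Y => //; have [+ _ _ _] := FQ _ FY; apply=> //; exact: XY.
    + by exists X => //; have [+ _ _ _] := FQ _ FX; apply=> //; exact: YX.
  - by move=> a b [X FX Xb]; exists X => //; have [_ + _ _] := FQ _ FX; exact.
  - move=> [x [X FX Xx]] y Iy; exists X => //; have [_ _ + _] := FQ _ FX.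
    by apply=> //; exists x.
  - by move=> a [X FX Xa]; have [_ _ _] := FQ _ FX; exact.
have IP : I `<=` P.
  have [P0|/set0P/PI//] := eqVneq P set0.
  have PI' : P `<` I by rewrite P0; split; [exact: sub0set | move=> h; exact: (h 0 I0)].
  by exfalso; apply: (Pmax I PI'); split=> // _ x.
exists P; split=> //; split=> //; first exact: IP.
  by move=> P1; exact: PS P1 S1.
move=> a b Pab; apply: contrapT => /not_orP[Pa Pb].
have meet c : ~ P c -> exists p x, P p /\ S (p + x * c).
  move=> Pc; apply: contrapT => /forallNP H.
  apply: (Pmax [set y | exists p x, P p /\ y = p + x * c]).
    split=> [y Py|]; first by exists y, 0; rewrite mul0r addr0.
    move=> /(_ c) h; apply/Pc/h; exists 0, 1.
    by rewrite mul1r add0r; split=> //; exact: IP.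
  split.
  - move=> _ _ [p [x [Pp ->]]] [p' [x' [Pp' ->]]]; exists (p + p'), (x + x').
    by split; [exact: PD | rewrite mulrDl addrACA].
  - move=> d _ [p [x [Pp ->]]]; exists (d * p), (d * x).
    by split; [exact: PM | rewrite mulrDr mulrA].
  - by move=> _ y Iy; exists y, 0; split; [exact: IP | rewrite mul0r addr0].
  - by move=> _ [p [x [Pp ->]]] h; apply: (H p); exists x.
have [p [x [Pp Sp]]] := meet _ Pa; have [q [y [Pq Sq]]] := meet _ Pb.
apply: PS (SM _ _ Sp Sq).
rewrite (_ : _ * _ = (q + y * b) * p + (x * a) * q + (x * y) * (a * b)); last by ring.
by apply: (PD); [apply: (PD)|]; apply: (PM).
Qed.

(** * Linear independence and tensor products *)

(** A shortest family whose span contains all the [a i] is independent: a relation with nonzero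
    coefficient at [j] would allow [e j] to be eliminated. *)
Lemma lin_basis (k : fieldType) (R : comPzRingType) (alpha : {rmorphism k -> R})
    (n : nat) (a : 'I_n -> R) :
  exists r (e : 'I_r -> R) (m : 'I_n -> 'I_r -> k),
    lin_indep alpha e /\ forall i, a i = \sum_(l < r) alpha (m i l) * e l.
Proof.
pose sp r := `[< exists (e : 'I_r -> R) (m : 'I_n -> 'I_r -> k),
   forall i, a i = \sum_(l < r) alpha (m i l) * e l >].
have spn : exists r, sp r.
  exists n; apply/asboolP; exists a, (fun i l => (i == l)%:R) => i.
  rewrite (bigD1 i) //= eqxx rmorph1 mul1r big1 ?addr0 // => l /negbTE h.
  by rewrite eq_sym h rmorph0 mul0r.
case: (ex_minnP spn) => r /asboolP[e [m em]] rmin.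
exists r, e, m; split=> // c c0 j; apply: contrapT => cj.
case: r e m em c c0 j cj rmin => [|r] e m em c c0 j cj rmin; first by case: (j).
move/eqP: cj => cj.
suff /rmin : sp r by rewrite ltnn.
apply/asboolP; exists (e \o lift j).
exists (fun i l => m i (lift j l) - m i j * (c (lift j l) / c j)) => i.
have ej : e j = - \sum_(l < r) alpha (c (lift j l) / c j) * e (lift j l).
  have := congr1 (fun x => alpha (c j)^-1 * x) c0.
  rewrite mulr0 (bigD1_ord j) //= mulrDr mulrA -rmorphM mulVf // rmorph1 mul1r.
  move/eqP; rewrite addr_eq0 => /eqP ->; rewrite mulr_sumr; congr (- _).
  by apply: eq_bigr => l _; rewrite mulrA -rmorphM mulrC [_^-1 * _]mulrC mulrC.
rewrite em (bigD1_ord j) //= ej mulrN mulr_sumr addrC -sumrB.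
apply: eq_bigr => l _ /=; rewrite rmorphB rmorphM; ring.
Qed.

Section Tensor.
Variables (k : fieldType) (A B C : comPzRingType).
Variables (alpha : {rmorphism k -> A}) (iota : {rmorphism k -> B}).
Variables (u : {rmorphism A -> C}) (v : {rmorphism B -> C}).
Hypothesis uv : forall c, u (alpha c) = v (iota c).
Hypothesis tens : is_tensor alpha u v.

(** Scalars of [k] cross the tensor sign. [s] and [t] are arbitrary so that one regrouping serves
    both in [C] and in the target of a homomorphism out of [C]. *)
Lemma tensor_regroup (M : comPzRingType) (s : {rmorphism A -> M})
    (t : {rmorphism B -> M}) (st : forall c, s (alpha c) = t (iota c))
    n r (a : 'I_n -> A) (b : 'I_n -> B) (e : 'I_r -> A) (m : 'I_n -> 'I_r -> k) :
  (forall i, a i = \sum_(l < r) alpha (m i l) * e l) ->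
  \sum_(i < n) s (a i) * t (b i) =
  \sum_(l < r) s (e l) * t (\sum_(i < n) iota (m i l) * b i).
Proof.
move=> am.
under eq_bigr => i _ do rewrite am rmorph_sum mulr_suml.
rewrite exchange_big /=; apply: eq_bigr => l _.
rewrite rmorph_sum mulr_sumr; apply: eq_bigr => i _.
by rewrite !rmorphM st mulrA [t _ * s _]mulrC.
Qed.

Lemma tensor_basis (c : C) : exists r (e : 'I_r -> A) (b : 'I_r -> B),
  lin_indep alpha e /\ c = \sum_(l < r) u (e l) * v (b l).
Proof.
have [n [a [b ->]]] := tens.1 c.
have [r [e [m [ie am]]]] := lin_basis alpha a.
by exists r, e, (fun l => \sum_(i < n) iota (m i l) * b i);
  rewrite (tensor_regroup uv _ am).
Qed.

(** The point is well-definedness: a sum representing 0, regrouped along independent first factors,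
    has all its second factors equal to 0, so its image vanishes too. *)
Lemma tensor_lift (M : comPzRingType) (s : {rmorphism A -> M})
    (t : {rmorphism B -> M}) : (forall c, s (alpha c) = t (iota c)) ->
  exists g : {rmorphism C -> M}, (forall a, g (u a) = s a) /\ (forall b, g (v b) = t b).
Proof.
move=> st.
pose G (x : C) (y : M) := exists l : seq (A * B),
  x = \sum_(z <- l) u z.1 * v z.2 /\ y = \sum_(z <- l) s z.1 * t z.2.
have G0 y : G 0 y -> y = 0.
  case=> l [x0 ->].
  move: x0; rewrite !(big_nth (0, 0)) !big_mkord => /esym.
  have [r [e [m [ie am]]]] := lin_basis alpha (fun i : 'I_(size l) => (nth (0, 0) l i).1).
  rewrite (tensor_regroup uv _ am) (tensor_regroup st _ am) => /(tens.2 _ _ _ ie) e0.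
  by rewrite big1 // => i _; rewrite e0 rmorph0 mulr0.
have GB x x' y y' : G x y -> G x' y' -> G (x - x') (y - y').
  case=> l [-> ->] [l' [-> ->]].
  exists (l ++ [seq (- z.1, z.2) | z <- l']); rewrite !big_cat !big_map /= -!sumrN.
  by split; congr (_ + _); apply: eq_bigr => z _; rewrite rmorphN mulNr.
have [||||| g gP] := @rmorph_of_rel C M G.
- move=> x; have [n [a [b ->]]] := tens.1 x.
  exists (\sum_(i < n) s (a i) * t (b i)), [seq (a i, b i) | i <- index_enum 'I_n].
  by rewrite !big_map.
- move=> x y y' h h'; apply/eqP; rewrite -subr_eq0; apply/eqP/G0.
  by rewrite -(subrr x); exact: GB.
- by exists [:: (1, 1)]; rewrite !big_seq1 !rmorph1 !mulr1.
- exact: GB.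
- move=> x x' y y' [l [-> ->]] [l' [-> ->]].
  exists [seq (z.1 * z'.1, z.2 * z'.2) | z <- l, z' <- l'].
  rewrite !big_distrlr !big_allpairs_dep /=.
  by split; apply: eq_bigr => z _; apply: eq_bigr => z' _; rewrite !rmorphM mulrACA.
have Geq x y : G x y -> g x = y.
  move=> h; apply/eqP; rewrite -subr_eq0; apply/eqP/G0.
  by rewrite -(subrr x); exact: GB.
exists g; split=> [a|b]; apply: Geq.
  by exists [:: (a, 1)]; rewrite !big_seq1 !rmorph1 !mulr1.
by exists [:: (1, b)]; rewrite !big_seq1 !rmorph1 !mul1r.
Qed.

End Tensor.

Lemma lin_indep_map (k M : fieldType) (R : comPzRingType) (alpha : {rmorphism k -> R})
    (g : {rmorphism R -> M}) n (a : 'I_n -> R) :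
  (forall x, g x = 0 -> x = 0) -> lin_indep alpha a -> lin_indep (g \o alpha) (g \o a).
Proof.
move=> gi ia c; under eq_bigr => i _ do rewrite /= -rmorphM.
by rewrite -rmorph_sum => /gi; exact: ia.
Qed.

(* A relation scaled so that one coefficient is 1 is moved by [phi] to a relation
   between the [phi (a i)] whose difference with the original one is shorter. *)
Lemma casorati (k L : fieldType) (j : {rmorphism k -> L}) (phi : {rmorphism L -> L}) :
  (forall c, phi (j c) = j c) ->
  (forall x, phi x = x -> exists c, x = j c) ->
  forall n (a b : 'I_n -> L), lin_indep j a ->
  (forall m, \sum_(i < n) iter m phi (a i) * b i = 0) -> forall i, b i = 0.
Proof.
move=> phij inv; elim=> [|n IHn] a b ia ab i; first by case: i.
apply: contrapT => /eqP bi.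
pose b' l := b l / b i.
have ab' m : \sum_(l < n.+1) iter m phi (a l) * b' l = 0.
  under eq_bigr => l _ do rewrite mulrA.
  by rewrite -mulr_suml ab mul0r.
have b'i : b' i = 1 by rewrite /b' divff.
pose c l := phi (b' (lift i l)) - b' (lift i l).
have c0 l : c l = 0.
  apply: (IHn (fun l => phi (a (lift i l)))) => [d|m].
    have -> : \sum_(l < n) j (d l) * phi (a (lift i l)) =
       phi (\sum_(l < n) j (d l) * a (lift i l)).
      by rewrite rmorph_sum; apply: eq_bigr => ? _; rewrite rmorphM phij.
    move=> /eqP; rewrite fmorph_eq0 => /eqP d0 l'.
    have := ia (fun x => if unlift i x is Some y then d y else 0).
    rewrite (bigD1_ord i) //= unlift_none rmorph0 mul0r add0r.
    under eq_bigr => x _ do rewrite liftK.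
    by move=> /(_ d0 (lift i l')); rewrite liftK.
  have h1 := ab' m.+1; have h2 := congr1 phi (ab' m).
  move: h2; rewrite rmorph0 rmorph_sum (bigD1_ord i) //= b'i rmorphM rmorph1 mulr1.
  move: h1; rewrite (bigD1_ord i) //= b'i mulr1 => h1 h2.
  rewrite -[RHS](subrr 0) -[X in _ = X - _]h2 -[X in _ = _ - X]h1 opprD addrACA subrr add0r -sumrB.
  apply: eq_bigr => l' _; rewrite -iterSr /= rmorphM /c; ring.
(* The ratios [b l / b i] are thus invariant, hence constants; the relation for [m = 0] then
   contradicts the independence of the [a l], since its coefficient at [i] is 1. *)
have b'inv l : phi (b' l) = b' l.
  case: (unliftP i l) => [l' ->|->]; last by rewrite b'i rmorph1.
  by apply/eqP; rewrite -subr_eq0; apply/eqP/c0.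
have [d dP] := choice (fun l => inv _ (b'inv l)).
have di : d i = 0.
  apply: (ia d) => //; rewrite -[RHS](ab' 0%N) /=.
  by apply: eq_bigr => l _; rewrite dP mulrC.
by have := dP i; rewrite di b'i rmorph0 => /eqP; rewrite oner_eq0.
Qed.

(** The [b i] are expanded along a family of [K] that is independent over the image of [sigma].
    Independence splits every relation into one relation over [L] for each member of that family. *)
Lemma casorati_ext (k L K : fieldType) (j : {rmorphism k -> L})
    (phi : {rmorphism L -> L}) (sigma : {rmorphism L -> K}) :
  (forall c, phi (j c) = j c) ->
  (forall x, phi x = x -> exists c, x = j c) ->
  forall n (a : 'I_n -> L) (b : 'I_n -> K), lin_indep j a ->
  (forall m, \sum_(i < n) sigma (iter m phi (a i)) * b i = 0) -> forall i, b i = 0.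
Proof.
move=> phij inv n a b ia ab i.
have [r [e [q [ie bq]]]] := lin_basis sigma b.
suff q0 l : q i l = 0.
  by rewrite bq big1 // => l _; rewrite q0 rmorph0 mul0r.
apply: (casorati phij inv (b := fun i => q i l) ia) => m.
apply: (ie (fun l => \sum_(i < n) iter m phi (a i) * q i l)).
rewrite -[RHS](ab m).
under eq_bigr => l' _ do rewrite rmorph_sum mulr_suml.
rewrite exchange_big; apply: eq_bigr => i' _ /=.
rewrite bq mulr_sumr; apply: eq_bigr => l' _; rewrite rmorphM; ring.
Qed.

(** * Transcendence and chains of prime ideals *)

Section EvalPoly.
Variables (R : idomainType) (L : fieldType) (ev : {rmorphism R -> L}).

Definition evp (y : L) : {poly R} -> L := horner_morph (fun x => mulrC y (ev x)).

HB.instance Definition _ y := GRing.RMorphism.on (evp y).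

Lemma evpE y p : evp y p = (map_poly ev p).[y].
Proof. by []. Qed.

Lemma evpC y c : evp y c%:P = ev c. Proof. exact: horner_morphC. Qed.

Lemma evpX y : evp y 'X = y. Proof. exact: horner_morphX. Qed.

Definition transc (y : L) : Prop := forall p : {poly R}, evp y p = 0 -> p = 0.

Lemma transc_inj y : transc y -> forall x, ev x = 0 -> x = 0.
Proof.
by move=> ty x evx; apply/eqP; rewrite -polyC_eq0; apply/eqP/ty; rewrite evpC.
Qed.

(** With [g] the image of the leading coefficient and [m + 1] the degree of [q], the equation of [x]
    multiplied by [g ^+ m] is a monic equation for [g * x]. *)
Lemma integral_lead (q : {poly R}) (x : L) : (1 < size q)%N ->
  evp x q = 0 -> integralOver ev (ev (lead_coef q) * x).
Proof.
case s: (size q) => [|[|m]] // _ qx; pose g := ev (lead_coef q).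
pose c j := if j == m.+1 then 1 else ev q`_j * g ^+ (m - j).
have sc : size (\poly_(j < m.+2) c j) = m.+2.
  by apply: size_poly_eq; rewrite /c eqxx oner_neq0.
apply: (@integral_root_monic _ _ _ _ (\poly_(j < m.+2) c j)).
- by rewrite monicE lead_coefE sc coef_poly ltnSn /c eqxx.
- apply/rootP; rewrite horner_poly big_ord_recr /= /c eqxx mul1r.
  transitivity (g ^+ m * evp x q); last by rewrite qx mulr0.
  rewrite evpE (@horner_coef_wide _ m.+2); last by rewrite -s; exact: size_poly.
  rewrite [in RHS]big_ord_recr mulrDr mulr_sumr; congr (_ + _).
    apply: eq_bigr => i _; rewrite (ltn_eqF (ltn_ord i)) coef_map /=.
    rewrite exprMn -/g; have := subnK (leq_ord i) => e;
      rewrite -[X in _ = g ^+ X * _]e exprD; ring.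
  have gE : ev q`_m.+1 = g by rewrite /g lead_coefE s.
  by rewrite coef_map /= gE exprMn -/g exprS; ring.
- move=> z /(nthP 0)[i]; rewrite sc => _ <-; rewrite coef_poly; case: ifP => // _.
    rewrite /c; case: ifP => _; first exact: integral1.
    by rewrite -rmorphXn -rmorphM; exact: integral_id.
  exact: integral0.
Qed.

End EvalPoly.

(** Adjoining [a] then [y] or [y] then [a] gives the same values; this is the exchange property in
    terms of polynomials. *)
Lemma evp_swap (R : idomainType) (L : fieldType) (ev : {rmorphism R -> L}) a y
    (p : {poly {poly R}}) :
  evp (evp ev a) y p = evp (evp ev y) a (swapXY p).
Proof.
have map_evp b (q : {poly {poly R}}) :
    map_poly (evp ev b) q = map_poly (horner_eval b) (map_poly (map_poly ev) q).
  by rewrite -map_poly_comp.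
rewrite !evpE !map_evp.
have h b c (u : {poly {poly L}}) : (map_poly (horner_eval b) u).[c] = u.[c%:P].[b].
  have <- : horner_eval b c%:P = c by rewrite /horner_eval hornerC.
  by rewrite horner_map /horner_eval hornerC.
by rewrite !h -swapXY_map horner2_swapXY.
Qed.

(** A bare predicate, because it is applied both to the image of [A] in a residue field and to the
    elements integral up to a power of [g]. *)
Definition subring_set (L : pzRingType) (D : set L) : Prop :=
  [/\ D 1, forall x y, D x -> D y -> D (x - y) & forall x y, D x -> D y -> D (x * y)].

Section SubringSet.
Variables (L : pzRingType) (D : set L) (sD : subring_set D).

Lemma subring_set1 : D 1. Proof. by case: sD. Qed.
Lemma subring_setB x y : D x -> D y -> D (x - y). Proof. by case: sD => _ + _; exact. Qed.
Lemma subring_setM x y : D x -> D y -> D (x * y). Proof. by case: sD => _ _; exact. Qed.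
Lemma subring_set0 : D 0.
Proof. by rewrite -(subrr 1); apply: subring_setB; exact: subring_set1. Qed.
Lemma subring_setD x y : D x -> D y -> D (x + y).
Proof.
move=> Dx Dy; rewrite -[y]opprK -[- y]sub0r.
by apply: subring_setB => //; apply: subring_setB => //; exact: subring_set0.
Qed.

End SubringSet.

Lemma evp_subring (R : idomainType) (L : fieldType) (ev : {rmorphism R -> L})
    (D : set L) (y : L) :
  subring_set D -> (forall x, D (ev x)) -> D y -> forall p, D (evp ev y p).
Proof.
move=> sD Dev Dy; elim/poly_ind => [|p c IH]; first by rewrite rmorph0; exact: subring_set0.
rewrite rmorphD rmorphM /= evpC evpX.
by apply: subring_setD => //; apply: subring_setM.
Qed.

Definition alg_over (R : idomainType) (L : fieldType) (ev : {rmorphism R -> L}) (a : L) :=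
  exists2 q : {poly R}, q != 0 & evp ev a q = 0.

Lemma not_alg_over (R : idomainType) (L : fieldType) (ev : {rmorphism R -> L}) (a : L) :
  ~ alg_over ev a -> transc ev a.
Proof. by move=> na p pa; apply/eqP/negP => /negP p0; apply: na; exists p. Qed.

Lemma alg_over_map (R R' : idomainType) (L : fieldType) (ev : {rmorphism R -> L})
    (ev' : {rmorphism R' -> L}) (j : {rmorphism R -> R'}) (a : L) :
  injective j -> (forall x, ev' (j x) = ev x) -> alg_over ev a -> alg_over ev' a.
Proof.
move=> jinj evj [q q0 qa]; exists (map_poly j q).
  apply: contra q0 => /eqP/polyP q0; apply/eqP/polyP => i.
  by apply: jinj; rewrite -coef_map q0 !coef0 rmorph0.
rewrite -qa !evpE -map_poly_comp; congr (_.[_]).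
by apply: eq_map_poly => x /=; rewrite evj.
Qed.

(* An element of [l] that is transcendental over [R[y]] is adjoined to [R]; by exchange
   [y] remains transcendental. *)
Lemma transc_extend (L : fieldType) (y : L) (D : set L) (l : seq L)
    (R : idomainType) (ev : {rmorphism R -> L}) :
  subring_set D -> (forall x, D (ev x)) -> (forall a, a \in l -> D a) ->
  transc ev y ->
  exists (R' : idomainType) (j : {rmorphism R -> R'}) (ev' : {rmorphism R' -> L}),
    [/\ injective j, forall x, ev' (j x) = ev x, forall x, D (ev' x), transc ev' y &
        forall a, a \in l -> alg_over (evp ev' y) a].
Proof.
move=> sD; elim: l => [|a l IH] Dev Dl ty; first by exists R, idfun, ev; split.
have [|R' [j [ev' [jinj evj Dev' ty' algl]]]] := IH Dev _ ty.
  by move=> b bl; apply: Dl; rewrite inE bl orbT.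
have [alga|na] := pselect (alg_over (evp ev' y) a).
  exists R', j, ev'; split=> // b; rewrite inE => /orP[/eqP ->//|]; exact: algl.
exists {poly R'}, (polyC \o j), (evp ev' a); split.
- by move=> x x' /polyC_inj/jinj.
- by move=> x; rewrite /= evpC evj.
- by apply: evp_subring => //; apply: Dl; rewrite inE eqxx.
- move=> p; rewrite evp_swap => /(not_alg_over na)/eqP.
  by rewrite swapXY_eq0 => /eqP.
- have H b : alg_over (evp ev' y) b -> alg_over (evp (evp ev' a) y) b.
    apply: (@alg_over_map _ _ _ _ _ (map_poly polyC)) => [|q].
      exact: map_inj_poly (@polyC_inj _) (rmorph0 _).
    rewrite /= !evpE -map_poly_comp; congr (_.[_]).
    by apply: eq_map_poly => x /=; rewrite evpC.
  move=> b; rewrite inE => /orP[/eqP ->|/algl/H//].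
  (* The innermost variable now takes the value [a], so [a] is a root of this linear polynomial. *)
  exists ('X - ('X%:P)%:P); first by rewrite polyXsubC_eq0.
  by rewrite rmorphB /= evpX evpC /= evpC /= evpX subrr.
Qed.

Lemma alg_over_integral (L : fieldType) (R : idomainType) (ev : {rmorphism R -> L})
    (l : seq L) :
  (forall x, ev x = 0 -> x = 0) -> (forall a, a \in l -> alg_over ev a) ->
  exists2 g, g != 0 & forall a, a \in l -> integralOver ev (ev g * a).
Proof.
move=> inj; elim: l => [|a l IH] algl; first by exists 1; rewrite ?oner_neq0.
have [|g g0 gl] := IH; first by move=> b bl; apply: algl; rewrite inE bl orbT.
have [q q0 qa] := algl a (mem_head _ _).
have sq : (1 < size q)%N.
  rewrite ltnNge; apply/negP => /size1_polyC qE; case/negP: q0.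
  by move: qa; rewrite qE evpC => /inj ->.
exists (g * lead_coef q); first by rewrite mulf_neq0 // lead_coef_eq0.
move=> b; rewrite inE => /orP[/eqP ->|bl]; rewrite rmorphM.
  by rewrite -mulrA; apply: integral_mul; [exact: integral_id | exact: integral_lead].
by rewrite mulrAC; apply: integral_mul; [exact: gl | exact: integral_id].
Qed.

(** These are the elements that become integral once [g] is inverted. As they form a subring, a
    denominator that works for the generators of an algebra works for all its elements, with an
    exponent depending on the element. *)
Lemma integral_scaled_subring (L : fieldType) (R : idomainType)
    (ev : {rmorphism R -> L}) (g : R) :
  subring_set [set x | exists N, integralOver ev (ev g ^+ N * x)].
Proof.
have gN N : integralOver ev (ev g ^+ N) by rewrite -rmorphXn; exact: integral_id.
split=> [|x y [N Nx] [M My]|x y [N Nx] [M My]].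
- by exists 0%N; rewrite mul1r; exact: integral1.
- exists (N + M)%N; rewrite exprD.
  rewrite (_ : _ * _ = ev g ^+ M * (ev g ^+ N * x) - ev g ^+ N * (ev g ^+ M * y)).
    by apply: integral_sub; apply: integral_mul.
  ring.
- exists (N + M)%N; rewrite exprD.
  rewrite (_ : _ * _ = (ev g ^+ N * x) * (ev g ^+ M * y)); first exact: integral_mul.
  ring.
Qed.

(* If [s = (1 + y g) x] with [g ^ N x] integral, then clearing denominators shows
   that [1 + y g] divides a power of [s], since [y g = - 1] modulo [1 + y g]. *)
Lemma constant_nondivisible (L : fieldType) (R : idomainType) (ev : {rmorphism R -> L})
    (y : L) (g : {poly R}) (x : L) (s : R) (N : nat) :
  transc ev y -> g != 0 -> integralOver (evp ev y) (evp ev y g ^+ N * x) ->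
  ev s = evp ev y (1 + 'X * g) * x -> s = 0.
Proof.
move=> ty g0 [p pm px] sx; apply/eqP; apply: contraT => s0.
pose h := 1 + 'X * g; pose m := (size p).-1.
have dvdh : exists c : {poly R}, (g ^+ N * s%:P) ^+ m = h * c.
  exists (- \sum_(i < m) p`_i * (g ^+ N * s%:P) ^+ i * h ^+ (m - i).-1).
  apply/eqP; rewrite -subr_eq0 mulrN opprK; apply/eqP/ty.
  have sp : size p = m.+1 by rewrite prednK // size_poly_gt0 monic_neq0.
  set H := evp ev y h; set w := evp ev y g ^+ N * x.
  have WE : evp ev y (g ^+ N * s%:P) = H * w.
    by rewrite rmorphM rmorphXn /= evpC sx -/h -/H /w; ring.
  have := congr1 (fun z => H ^+ m * z) (rootP px).
  rewrite mulr0 (@horner_coef_wide _ m.+1); last by rewrite -sp; exact: size_poly.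
  move=> <-; rewrite big_ord_recr /= mulrDr addrC rmorphD /=; congr (_ + _).
    rewrite rmorphM rmorph_sum !mulr_sumr; apply: eq_bigr => i _.
    rewrite coef_map /= !rmorphM !rmorphXn /= WE -/H -/w exprMn.
    have -> : H ^+ m = H ^+ i * (H * H ^+ (m - i).-1).
      by rewrite -exprS prednK ?subn_gt0 // -exprD subnKC // ltnW.
    by ring.
  rewrite rmorphXn /= WE exprMn coef_map /= -/w.
  by rewrite -lead_coefE (monicP pm) rmorph1 mul1r.
case: dvdh => c hc.
have [c' hc'] : exists c', s%:P ^+ m = h * c'.
  have [e he] : exists e, ('X * g) ^+ (N * m) = h * e + (-1) ^+ (N * m).
    elim: (N * m)%N => [|i [e he]]; first by exists 0; rewrite mulr0 add0r.
    exists (('X * g) * e + (-1) ^+ i); rewrite exprS he exprS /h; ring.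
  exists ((-1) ^+ (N * m) * ('X ^+ (N * m) * c - e * s%:P ^+ m)).
  have -> : h * ((-1) ^+ (N * m) * ('X ^+ (N * m) * c - e * s%:P ^+ m)) =
    (-1) ^+ (N * m) * ('X ^+ (N * m) * (h * c) - (h * e) * s%:P ^+ m) by ring.
  rewrite -hc exprMn -exprM -(addrK ((-1) ^+ (N * m)) (h * e)) -he exprMn.
  rewrite (_ : _ - _ = (-1) ^+ (N * m) * s%:P ^+ m); last by ring.
  by rewrite mulrA -expr2 sqrr_sign mul1r.
have hs : (1 < size h)%N.
  rewrite /h addrC size_polyDl size_mul ?polyX_eq0 // size_polyX /= ?size_poly1 ?ltnS ?size_poly_gt0 //.
have c0 : c' != 0.
  by apply: contra s0 => /eqP c0; move: hc'; rewrite c0 mulr0 => /eqP;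
    rewrite expf_eq0 polyC_eq0 => /andP[].
have := congr1 (fun p : {poly R} => size p) hc'.
rewrite -rmorphXn size_polyC expf_neq0 // size_mul //; last first.
  by rewrite -size_poly_gt0 (ltn_trans _ hs).
have := hs; case: (size h) => [|[|z]] // _; rewrite addSn /=.
by have := c0; rewrite -size_poly_gt0; case: (size c') => [|z'] // _; rewrite addnS.
Qed.

Section AlgIndep.
Import mpoly Trdeg.

Lemma mpoly_rmorph_ext (n : nat) (k S : nzRingType) (f g : {rmorphism {mpoly k[n]} -> S}) :
  (forall c, f c%:MP = g c%:MP) -> (forall i, f 'X_i = g 'X_i) -> f =1 g.
Proof.
move=> fgC fgX q; rewrite [q]mpolyE !rmorph_sum; apply: eq_bigr => m _.
rewrite -mul_mpolyC !rmorphM fgC mpolyXE_id !rmorph_prod; congr (_ * _).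
by apply: eq_bigr => i _; rewrite !rmorphXn fgX.
Qed.

Definition snoc (T : Type) n (z : 'I_n -> T) (w : T) : 'I_n.+1 -> T :=
  fun i => if unlift ord_max i is Some j then z j else w.

Lemma snoc_lift (T : Type) n (z : 'I_n -> T) (w : T) j : snoc z w (lift ord_max j) = z j.
Proof. by rewrite /snoc liftK. Qed.

Lemma snoc_max (T : Type) n (z : 'I_n -> T) (w : T) : snoc z w ord_max = w.
Proof. by rewrite /snoc unlift_none. Qed.

Lemma snoc_comp (T U : Type) (f : T -> U) n (z : 'I_n -> T) (w : T) :
  f \o snoc z w = snoc (f \o z) (f w).
Proof. by apply/funext => i /=; rewrite /snoc; case: unlift. Qed.

Lemma snoc_eta (T : Type) n (z : 'I_n.+1 -> T) : z = snoc (z \o lift ord_max) (z ord_max).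
Proof. by apply/funext => i; case: (unliftP ord_max i) => [j|] ->;
  rewrite ?snoc_lift ?snoc_max. Qed.

Section Bridge.
Variables (k L : fieldType) (iota : {rmorphism k -> L}).

Lemma mmap_var n (t : 'I_n -> L) i : mmap iota t 'X_i = t i.
Proof. by rewrite mmapX mmap1U. Qed.

(** With [mpoly_of_poly] this is the isomorphism that singles out the last variable. It turns
    independence of [n.+1] elements into transcendence of the last one over the polynomials in the
    others. *)
Definition mpoly_to_poly n : {rmorphism {mpoly k[n.+1]} -> {poly {mpoly k[n]}}} :=
  mmap (polyC \o @mpolyC n k) (snoc (fun j => ('X_j)%:P) 'X).

Definition mpoly_of_poly n : {rmorphism {poly {mpoly k[n]}} -> {mpoly k[n.+1]}} :=
  horner_morph (fun x => mulrC 'X_ord_max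
    (mmap (@mpolyC n.+1 k) (fun j => 'X_(lift ord_max j)) x)).

Local Notation to_poly := (@mpoly_to_poly _).
Local Notation of_poly := (@mpoly_of_poly _).

Let to_polyC n c : @mpoly_to_poly n c%:MP = (c%:MP)%:P.
Proof. by rewrite /mpoly_to_poly /= mmapC. Qed.

Let to_polyX n i : @mpoly_to_poly n 'X_i = snoc (fun j => ('X_j)%:P) 'X i.
Proof. by rewrite /mpoly_to_poly /= mmapX mmap1U. Qed.

Let of_polyC n c : @mpoly_of_poly n c%:P = mmap (@mpolyC n.+1 k) (fun j => 'X_(lift ord_max j)) c.
Proof. exact: horner_morphC. Qed.

Let of_polyX n : @mpoly_of_poly n 'X = 'X_ord_max.
Proof. exact: horner_morphX. Qed.

Let to_polyK n (q : {mpoly k[n.+1]}) : of_poly (to_poly q) = q.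
Proof.
rewrite -[RHS]/(idfun q) -[LHS]/((@mpoly_of_poly n \o @mpoly_to_poly n) q).
apply: mpoly_rmorph_ext => [c|i] /=; first by rewrite to_polyC of_polyC mmapC.
rewrite to_polyX; case: (unliftP ord_max i) => [j|] ->.
  by rewrite snoc_lift of_polyC mmapX mmap1U.
by rewrite snoc_max of_polyX.
Qed.

Let of_polyK n (p : {poly {mpoly k[n]}}) : to_poly (of_poly p) = p.
Proof.
elim/poly_ind: p => [|p c IH]; first by rewrite !rmorph0.
rewrite !(rmorphD, rmorphM) /= IH of_polyX to_polyX snoc_max; congr (_ + _).
rewrite of_polyC.
rewrite -[LHS]/((@mpoly_to_poly n \o mmap (@mpolyC n.+1 k) (fun j => 'X_(lift ord_max j))) c).
apply: mpoly_rmorph_ext => [d|i] /=; first by rewrite mmapC to_polyC.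
by rewrite mmapX mmap1U to_polyX snoc_lift.
Qed.

Let evp_to_poly n (z : 'I_n -> L) (w : L) (q : {mpoly k[n.+1]}) :
  evp (mmap iota z) w (to_poly q) = mmap iota (snoc z w) q.
Proof.
rewrite -[LHS]/((evp (mmap iota z) w \o @mpoly_to_poly n) q).
apply: mpoly_rmorph_ext => [c|i] /=.
  by rewrite to_polyC evpC /= !mmapC.
rewrite to_polyX mmap_var; case: (unliftP ord_max i) => [j|] ->.
  by rewrite !snoc_lift evpC /= mmap_var.
by rewrite !snoc_max evpX.
Qed.

Lemma alg_indep_snoc n (z : 'I_n -> L) (w : L) :
  alg_indep iota (snoc z w) <-> transc (mmap iota z) w.
Proof.
split=> [h p pw|h q qzw].
  by rewrite -[p]of_polyK (h (of_poly p)) ?rmorph0 // -evp_to_poly of_polyK.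
by rewrite -[q]to_polyK (h (to_poly q)) ?rmorph0 // evp_to_poly.
Qed.

Lemma mmap_subring n (z : 'I_n -> L) (D : set L) : subring_set D ->
  (forall c, D (iota c)) -> (forall i, D (z i)) -> forall q, D (mmap iota z q).
Proof.
move=> sD Dk Dz q; rewrite /mmap; elim/big_ind: _ => [|x y Dx Dy|m _].
- exact: subring_set0.
- exact: subring_setD.
apply: subring_setM => //; rewrite /mmap1; elim/big_ind: _ => [|x y Dx Dy|i _].
- exact: subring_set1.
- exact: subring_setM.
elim: (m i) => [|e IH]; first exact: subring_set1.
by rewrite exprS; exact: subring_setM.
Qed.

Lemma alg_indep_inj n (z : 'I_n -> L) : alg_indep iota z -> injective z.
Proof.
move=> iz i j zij; apply/eqP; rewrite -eq_mnm1.
have /eqP : 'X_i - 'X_j = 0 :> {mpoly k[n]} by apply: iz;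
  rewrite rmorphB /= !mmap_var zij subrr.
rewrite subr_eq0 => /eqP/(congr1 (mcoeff U_(j)%MM)); rewrite !mcoeffX eqxx.
by case: eqP => // _ /eqP; rewrite eq_sym oner_eq0.
Qed.

(** A longest independent subfamily exists because independent families are injective, which bounds
    the length by [m]; no generator can then be transcendental over it. *)
Lemma max_alg_indep m (a : 'I_m -> L) :
  exists n (s : 'I_n -> 'I_m), alg_indep iota (a \o s) /\
    forall i, alg_over (mmap iota (a \o s)) (a i).
Proof.
pose ok n := `[< exists s : 'I_n -> 'I_m, alg_indep iota (a \o s) >].
have ok0 : exists n, ok n.
  have s0 : 'I_0 -> 'I_m by case.
  exists 0%N; apply/asboolP; exists s0 => q.
  have -> : q = (q@_0%MM)%:MP.
    apply/mpolyP => e; rewrite mcoeffC (_ : e = 0%MM) ?eqxx ?mulr1 //.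
    by apply/mnmP => -[].
  by rewrite mmapC => /eqP; rewrite fmorph_eq0 => /eqP ->; rewrite rmorph0.
have okm n : ok n -> (n <= m)%N.
  move=> /asboolP[s /alg_indep_inj sinj].
  rewrite -[n]card_ord -[m]card_ord; apply: (@leq_card _ _ s).
  by move=> i j sij; apply: sinj; rewrite /= sij.
case: (ex_maxnP ok0 okm) => n /asboolP[s is_] nmax.
exists n, s; split=> // i; apply: contrapT => /not_alg_over /alg_indep_snoc h.
suff : ok n.+1 by move/nmax; rewrite ltnn.
by apply/asboolP; exists (snoc s i); rewrite snoc_comp.
Qed.

End Bridge.
End AlgIndep.

Section PrimeChain.
Import mpoly Trdeg.
Variables (k : fieldType) (A : comPzRingType) (alpha : {rmorphism k -> A}).

(** A single [x] represents [q] in every residue field at once, so that conditions modulo two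
    different primes can be compared. *)
Lemma mmap_lift n (y : 'I_n -> A) (q : {mpoly k[n]}) : exists x : A,
  forall (F : fieldType) (pr : {rmorphism A -> F}), pr x = mmap (pr \o alpha) (pr \o y) q.
Proof.
exists (\sum_(m <- msupp q) alpha q@_m * \prod_(i < n) y i ^+ m i) => F pr.
rewrite rmorph_sum; apply: eq_bigr => m _; rewrite rmorphM rmorph_prod; congr (_ * _).
by apply: eq_bigr => i _; rewrite rmorphXn.
Qed.

Lemma range_subring (F : fieldType) (pr : {rmorphism A -> F}) : subring_set (range pr).
Proof.
split=> [|_ _ [a _ <-] [b _ <-]|_ _ [a _ <-] [b _ <-]].
- by exists 1; rewrite ?rmorph1.
- by exists (a - b); rewrite ?rmorphB.
- by exists (a * b); rewrite ?rmorphM.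
Qed.

Hypothesis fg : finitely_generated alpha.

(** The last element [w] is given up and the others, [z], stay independent. The polynomials in [z]
    are enlarged to a polynomial ring [R'] inside [A/P] over which [w] is still transcendental and
    with [A/P] algebraic over [R'[w]], hence integral over it once a suitable [g] is inverted. Then
    no nonzero polynomial in [z] is a multiple of [1 + w g] modulo [P], and [P1] is a prime that
    contains this element and avoids those polynomials. *)
Lemma prime_step (P : set A) (F : fieldType) (pr : {rmorphism A -> F}) d
    (y : 'I_d.+1 -> A) :
  prime_ideal P -> (forall a, pr a = 0 <-> P a) ->
  alg_indep (pr \o alpha) (pr \o y) ->
  exists P1 : set A, [/\ prime_ideal P1, P `<` P1 &
    forall (F1 : fieldType) (pr1 : {rmorphism A -> F1}), (forall a, pr1 a = 0 <-> P1 a) ->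
      alg_indep (pr1 \o alpha) (pr1 \o (y \o lift ord_max))].
Proof.
move=> [P0 PD PM _ _] ker; rewrite [y]snoc_eta; set z := y \o _; set w := y _.
rewrite snoc_comp => iy; have tw := (alg_indep_snoc _ _ _).1 iy.
have [n [a gen]] := fg.
set ev := mmap _ _ in tw; pose l := [seq pr (a i) | i : 'I_n].
have [|x|b|R' [j [ev' [jinj evj Dev' tw' algl]]]] :=
  @transc_extend F (pr w) (range pr) l {mpoly k[d]} (mmap (pr \o alpha) (pr \o z)) _ _ _ tw.
- exact: range_subring.
- apply: mmap_subring; first exact: range_subring.
    by move=> c; exists (alpha c).
  by move=> i; exists (z i).
- by case/mapP => i _ ->; exists (a i).
have [g g0 gl] := alg_over_integral tw' algl.
(* [1 + 'X * g] involves [w] and is coprime to [g], so it does not become a unit when [g] is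
   inverted; [w] itself could divide [g]. *)
have [h _ hE] : range pr (evp ev' (pr w) (1 + 'X * g)).
  by apply: evp_subring => //; exact: range_subring.
have integ x : exists N, integralOver (evp ev' (pr w)) (evp ev' (pr w) g ^+ N * pr x).
  have sI := integral_scaled_subring (evp ev' (pr w)) g.
  apply: (gen [set x | exists N, integralOver (evp ev' (pr w)) (evp ev' (pr w) g ^+ N * pr x)]).
  - move=> c; exists 0%N; rewrite mul1r.
    have -> : pr (alpha c) = evp ev' (pr w) (j c%:MP)%:P by rewrite evpC evj /= mmapC.
    exact: integral_id.
  - by move=> i; exists 1%N; apply: gl; apply/mapP; exists i; rewrite // mem_enum.
  - by move=> u v hu hv; rewrite /= rmorphD; apply: (subring_setD sI).
  - by move=> u v hu hv; rewrite /= rmorphM; apply: (subring_setM sI).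
pose S := [set x | exists2 q : {mpoly k[d]}, q != 0 & pr x = mmap (pr \o alpha) (pr \o z) q].
have [|||||x|P1 [pP1 IP1 SP1]] := @prime_avoiding A [set x | exists p b, P p /\ x = p + h * b] S.
- by exists 0, 0; rewrite mulr0 addr0.
- move=> _ _ [p [b [Pp ->]]] [p' [b' [Pp' ->]]]; exists (p + p'), (b + b').
  by split; [exact: PD | rewrite mulrDr addrACA].
- move=> c _ [p [b [Pp ->]]]; exists (c * p), (c * b).
  by split; [exact: PM | rewrite mulrDr mulrCA].
- by exists 1; rewrite ?oner_neq0 // !rmorph1.
- move=> u v [q q0 uq] [q' q'0 vq]; exists (q * q'); first by rewrite mulf_neq0.
  by rewrite !rmorphM uq vq.
- move=> [p [b [/ker p0 ->]]] [q q0 qE]; case/negP: q0; apply/eqP.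
  apply: jinj; rewrite rmorph0.
  have [N iN] := integ b.
  apply: (constant_nondivisible tw' g0 iN).
  by rewrite evj /= -qE rmorphD rmorphM p0 add0r hE.
exists P1; split=> //.
  split=> [p Pp|P1P]; first by apply: IP1; exists p, 0; rewrite mulr0 addr0.
  have /P1P/ker : P1 h by apply: IP1; exists 0, 1; rewrite mulr1 add0r.
  rewrite hE => /tw'/(congr1 (fun p => p.[0])).
  by rewrite !hornerE => /eqP; rewrite oner_eq0.
move=> F1 pr1 ker1 q q1; apply/eqP; apply: contraPT q1 => q0.
have [x xE] := mmap_lift z q.
have -> : snoc z w \o lift ord_max = z by apply/funext => i /=; rewrite snoc_lift.
by rewrite -xE => /ker1 /SP1; apply; exists q.
Qed.

Lemma prime_chain d (P : set A) (F : fieldType) (pr : {rmorphism A -> F}) (y : 'I_d -> A) :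
  prime_ideal P -> (forall a, pr a = 0 <-> P a) ->
  alg_indep (pr \o alpha) (pr \o y) ->
  exists Z : nat -> set A, [/\ Z 0%N = P, forall i, (i <= d)%N -> prime_ideal (Z i) &
    forall i, (i < d)%N -> Z i `<` Z i.+1].
Proof.
elim: d P F pr y => [|d IH] P F pr y pP ker iy.
  by exists (fun=> P); split.
have [P1 [pP1 PP1 iP1]] := prime_step pP ker iy.
have [F1 [pr1 [ker1 _]]] := residue_field pP1.
have [Z [Z0 Zp Zlt]] := IH _ _ _ _ pP1 ker1 (iP1 _ _ ker1).
exists (fun i => if i is i'.+1 then Z i' else P); split=> // [[|i] //|[|i] /= h].
  exact: Zp.
  by rewrite Z0.
exact: Zlt.
Qed.

End PrimeChain.

(** * Embeddings into algebraically closed fields *)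

Lemma kernel_prime (A : comPzRingType) (F : fieldType) (pr : {rmorphism A -> F}) :
  prime_ideal [set a | pr a = 0].
Proof.
split=> [|a b /= a0 b0|a b /= b0||a b /=].
- exact: rmorph0.
- by rewrite rmorphD a0 b0 addr0.
- by rewrite rmorphM b0 mulr0.
- by rewrite /= rmorph1; apply/eqP; exact: oner_neq0.
- by rewrite rmorphM => /eqP; rewrite mulf_eq0 => /orP[] /eqP; [left|right].
Qed.

(* [E'] is the residue field of [E[X]] at the polynomials vanishing at [a]. *)
Lemma alg_extend (E L : fieldType) (K : closedFieldType) (e : {rmorphism E -> L})
    (t : {rmorphism E -> K}) (a : L) : alg_over e a ->
  exists (E' : fieldType) (j : {rmorphism E -> E'}) (e' : {rmorphism E' -> L})
    (t' : {rmorphism E' -> K}),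
    [/\ forall x, e' (j x) = e x, forall x, t' (j x) = t x & exists x, e' x = a].
Proof.
move=> alga.
have exm : exists m, `[< exists2 p : {poly E}, p != 0 & evp e a p = 0 /\ size p = m >].
  by case: alga => p p0 pa; exists (size p); apply/asboolP; exists p.
case: (ex_minnP exm) => m /asboolP[p p0 [pa sp]] mmin.
have pmin q : q != 0 -> evp e a q = 0 -> (size p <= size q)%N.
  by move=> q0 qa; rewrite sp; apply: mmin; apply/asboolP; exists q.
have sp1 : size p != 1%N.
  apply/negP => /eqP s1; have [c c0 pE] := size_poly1P _ (introT eqP s1).
  by move: pa; rewrite pE evpC => /eqP; rewrite fmorph_eq0 (negbTE c0).
have /closed_rootP[r pr0] : size (map_poly t p) != 1%N by rewrite size_map_poly.
(* [p] is the minimal polynomial of [a], and minimality makes it irreducible. Both evaluations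
   therefore have the multiples of [p] as kernel, and the residue field at this kernel maps to [L]
   and to [K]. *)
have ker q : evp t r q = 0 <-> evp e a q = 0.
  split=> [qr|qa].
    apply: contrapT => qa.
    suff cop : coprimep (map_poly t p) (map_poly t q).
      by have := coprimep_root cop pr0; rewrite -evpE qr eqxx.
    rewrite coprimep_map; apply: contrapT => /negP ncop.
    have := dvdp_gcdl p q; rewrite dvdp_eq; move/eqP.
    set g := gcdp p q in ncop *; set c := (p %/ g)%R => pE.
    have c0 : c != 0 by apply: contra p0 => /eqP c0; rewrite pE c0 mul0r.
    have g0 : g != 0 by apply: contra p0 => /eqP g0; rewrite pE g0 mulr0.
    move: (pa); rewrite {1}pE rmorphM => /eqP; rewrite mulf_eq0 => /orP[] /eqP h.
      have := pmin _ c0 h; rewrite {1}pE size_mul //.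
      move: ncop; rewrite /coprimep -/g; have := g0; rewrite -size_poly_gt0.
      by case: (size g) => [|[|w]] // _ _; rewrite addnS addnS /= -ltn_subRL subnn.
    have := dvdp_gcdr p q; rewrite -/g dvdp_eq => /eqP qE.
    by apply: qa; rewrite qE rmorphM /= h mulr0.
  have rem0 : (q %% p)%R = 0.
    apply/eqP; apply: contraT => rem0.
    have rema : evp e a (q %% p)%R = 0.
      by have := qa; rewrite {1}(divp_eq q p) rmorphD rmorphM /= pa mulr0 add0r.
    by have := pmin _ rem0 rema; rewrite leqNgt ltn_modp p0.
  rewrite (divp_eq q p) rem0 addr0 rmorphM /= [evp t r p](rootP pr0) mulr0.
  by [].
have [E' [q [qker qonto]]] := residue_field (kernel_prime (evp e a)).
have [e' e'E] := frac_lift qonto (t := evp e a) (fun x => iff_sym (qker x)).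
have [t' t'E] := frac_lift qonto (t := evp t r)
  (fun x => iff_trans (ker x) (iff_sym (qker x))).
exists E', (q \o polyC), e', t'; split=> [x|x|].
- by rewrite /= e'E /= evpC.
- by rewrite /= t'E /= evpC.
- by exists (q 'X); rewrite e'E /= evpX.
Qed.

Lemma alg_extends (L : fieldType) (K : closedFieldType) (l : seq L) (E : fieldType)
    (e : {rmorphism E -> L}) (t : {rmorphism E -> K}) :
  (forall a, a \in l -> alg_over e a) ->
  exists (E' : fieldType) (j : {rmorphism E -> E'}) (e' : {rmorphism E' -> L})
    (t' : {rmorphism E' -> K}),
    [/\ forall x, e' (j x) = e x, forall x, t' (j x) = t x &
      forall a, a \in l -> exists x, e' x = a].
Proof.
elim: l E e t => [|a l IH] E e t algl; first by exists E, idfun, e, t.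
have [E1 [j1 [e1 [t1 [e1E t1E [x1 x1E]]]]]] := alg_extend t (algl a (mem_head _ _)).
have [|E2 [j2 [e2 [t2 [e2E t2E l2]]]]] := IH E1 e1 t1.
  move=> b bl; apply: (alg_over_map (fmorph_inj j1) e1E).
  by apply: algl; rewrite inE bl orbT.
exists E2, (j2 \o j1), e2, t2; split=> [x|x|b] /=; rewrite ?e2E ?t2E //.
rewrite inE => /orP[/eqP ->|/l2 //]; exists (j2 x1); by rewrite e2E.
Qed.

Section Embedding.
Import mpoly Trdeg.

(** A rational function field [E] embeds in [L] by a transcendence basis and in [K] by an
    independent family of the same length. Adjoining the generators of [A] one at a time keeps a
    common source for both maps, until the map to [L] is onto and can be inverted. *)
Lemma field_embedding (k L : fieldType) (K : closedFieldType) (A : comPzRingType)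
    (alpha : {rmorphism k -> A}) (pr : {rmorphism A -> L}) (iota : {rmorphism k -> K}) :
  finitely_generated alpha -> frac_onto pr ->
  (forall d (y : 'I_d -> A), alg_indep (pr \o alpha) (pr \o y) ->
    trdeg_ge iota d) ->
  exists sigma : {rmorphism L -> K}, forall c, sigma (pr (alpha c)) = iota c.
Proof.
move=> [n [a gen]] onto trd.
have [d [s [inds algs]]] := max_alg_indep (pr \o alpha) (pr \o a).
have [t indt] := trd d (a \o s) inds.
pose ez : {rmorphism {mpoly k[d]} -> L} := mmap (pr \o alpha) ((pr \o a) \o s).
pose et : {rmorphism {mpoly k[d]} -> K} := mmap iota t.
have [E [q [qker qonto]]] := residue_field (kernel_prime ez).
have ker x : et x = 0 <-> q x = 0.
  split=> [/indt ->|/qker /inds ->]; exact: rmorph0.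
have [e eE] := frac_lift qonto (t := ez) (fun x => iff_sym (qker x)).
have [u uE] := frac_lift qonto (t := et) ker.
have qinj : injective q.
  move=> x x' xx'; apply/eqP; rewrite -subr_eq0; apply/eqP/inds.
  by apply/qker; rewrite rmorphB xx' subrr.
pose l := [seq pr (a i) | i : 'I_n].
have [b|E' [j [e' [u' [e'E u'E lE]]]]] := @alg_extends L K l E e u.
  by case/mapP => i _ ->; exact: (alg_over_map qinj eE (algs i)).
have surj x : exists y, e' y = x.
  have prA b : exists y, e' y = pr b.
    apply: (gen [set b | exists y, e' y = pr b]).
    - move=> c; exists (j (q c%:MP)).
      by rewrite e'E eE /= mmapC.
    - by move=> i; apply: lE; apply/mapP; exists i; rewrite // mem_enum.
    - by move=> b1 b2 [y1 h1] [y2 h2]; exists (y1 + y2); rewrite !rmorphD h1 h2.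
    - by move=> b1 b2 [y1 h1] [y2 h2]; exists (y1 * y2); rewrite !rmorphM h1 h2.
  have [b1 [b2 [_ ->]]] := onto x.
  have [y1 <-] := prA b1; have [y2 <-] := prA b2.
  by exists (y1 / y2); rewrite fmorph_div.
have [||||| sigma sE] := @rmorph_of_rel L K (fun x y => exists2 v, x = e' v & y = u' v).
- by move=> x; have [v <-] := surj x; exists (u' v), v.
- by move=> x y y' [v -> ->] [v' /fmorph_inj -> ->].
- by exists 1; rewrite rmorph1.
- by move=> x x' y y' [v -> ->] [v' -> ->]; exists (v - v'); rewrite rmorphB.
- by move=> x x' y y' [v -> ->] [v' -> ->]; exists (v * v'); rewrite rmorphM.
exists sigma => c.
have [v e1 ->] := sE (pr (alpha c)).
have -> : v = j (q c%:MP).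
  by apply: (fmorph_inj e'); rewrite -e1 e'E eE /= mmapC.
by rewrite u'E uE /= mmapC.
Qed.

End Embedding.

(** * Sections and germs *)

Section RingedSpace.
Variable X : ringedSpace.
Implicit Types U V W : opens X.

Lemma invertible_rmorph (R S : comPzRingType) (g : {rmorphism R -> S}) (s : R) :
  invertible s -> invertible (g s).
Proof. by case=> t st; exists (g t); rewrite -rmorphM st rmorph1. Qed.

Lemma invertibleM (R : comPzRingType) (s t : R) :
  invertible (s * t) <-> invertible s /\ invertible t.
Proof.
split=> [[w e]|[[s' e] [t' e']]].
  by split; [exists (t * w) | exists (s * w)]; rewrite -e; ring.
by exists (s' * t'); rewrite mulrACA e e' mulr1.
Qed.

Lemma inv_at_dom U (s : O U) x : inv_at s x -> oset U x.
Proof. by case=> V [h [Vx _]]; exact: h. Qed.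

Lemma inv_at_res U V (h : V `<=` U) (s : O U) x : oset V x ->
  inv_at (res h s) x <-> inv_at s x.
Proof.
move=> Vx; split=> [[W [hW [Wx iW]]]|[W [hW [Wx iW]]]].
  exists W, (subset_trans hW h); split=> //.
  by rewrite -(res_comp h hW).
have h1 : meetO V W `<=` W by exact: subIsetr.
have h2 : meetO V W `<=` V by exact: subIsetl.
exists (meetO V W), h2; split=> //.
rewrite (res_comp h h2 (subset_trans h1 hW)) -(res_comp hW h1).
exact: invertible_rmorph.
Qed.

Lemma inv_atM U (s t : O U) x : inv_at (s * t) x <-> inv_at s x /\ inv_at t x.
Proof.
split=> [[W [h [Wx]]]|[[V [h [Vx iV]]] [W [h' [Wx iW]]]]].
  by rewrite rmorphM => /invertibleM[is_ it]; split; exists W, h.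
have h1 : meetO V W `<=` V by exact: subIsetl.
have h2 : meetO V W `<=` W by exact: subIsetr.
exists (meetO V W), (subset_trans h1 h); split=> //; rewrite rmorphM; apply/invertibleM.
split; first by rewrite -(res_comp h h1); exact: invertible_rmorph.
rewrite (Prop_irrelevance (subset_trans h1 h) (subset_trans h2 h')) -(res_comp h' h2).
exact: invertible_rmorph.
Qed.

Lemma inv_at1 U x : oset U x -> inv_at (1 : O U) x.
Proof.
by move=> Ux; exists U, (@subset_refl _ U); split=> //; exists 1; rewrite rmorph1 mulr1.
Qed.

Lemma inv_atX U (s : O U) x n : inv_at s x -> inv_at (s ^+ n) x.
Proof.
move=> sx; elim: n => [|n IH]; first by apply: inv_at1; exact: inv_at_dom sx.
by rewrite exprS; apply/inv_atM.
Qed.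

Lemma section_empty U : (forall x, ~ oset U x) -> forall s t : O U, s = t.
Proof.
move=> U0 s t; apply: (@sheaf_sep X U False (fun f => match f with end)
  (fun f => match f with end)) => [x /U0 //|[]].
Qed.

(** If [s] is nowhere invertible then [basicO s] is empty, so 1 restricts to 0 there, and the
    localization axiom yields a power of [s] that kills 1. *)
Lemma affine_nilpotent U (s : O U) : affine U -> (forall x, ~ inv_at s x) ->
  exists n, s ^+ n = 0.
Proof.
case=> _ _ + _ s0 => /(_ s 1) [|n]; first exact: section_empty.
by rewrite mulr1; exists n.
Qed.

Hypothesis locX : locally_ringed X.

Lemma inv_at0 U x : ~ inv_at (0 : O U) x.
Proof.
move=> [V [h [Vx]]]; rewrite rmorph0 => -[t]; rewrite mul0r => /esym.
exact: locX.1 Vx.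
Qed.

Lemma inv_at_res0 U V (h : V `<=` U) (s : O U) x : oset V x -> res h s = 0 -> ~ inv_at s x.
Proof. by move=> Vx s0 /(inv_at_res h s Vx); rewrite s0; exact: inv_at0. Qed.

Lemma noninv_atD U (s t : O U) x : oset U x ->
  ~ inv_at s x -> ~ inv_at t x -> ~ inv_at (s + t) x.
Proof. by move=> Ux ns nt /(locX.2 _ _ _ _ Ux) []. Qed.

End RingedSpace.

HB.instance Definition _ (k : fieldType) (X : scheme k) (U : opens X) :=
  GRing.RMorphism.copy (@scal k X U)
    (res (@subsetT X U : U `<=` fullO X) \o sch_str X).

Lemma res_scal (k : fieldType) (X : scheme k) (U V : opens X) (h : V `<=` U) c :
  res h (scal U c) = scal V c.
Proof. exact: res_comp. Qed.

Section Integral.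
Variables (k : fieldType) (X : scheme k).
Hypotheses (irrX : irreducible_set [set: X]) (redX : reduced X).
Implicit Types U V W : opens X.

Definition nonempty_open U : Prop := oset U !=set0.

Lemma nonempty_meet U V : nonempty_open U -> nonempty_open V -> nonempty_open (meetO U V).
Proof.
move=> [x Ux] [y Vy]; apply: contrapT => nUV.
have cl W : closed (~` oset W) by apply: open_closedC; exact: opensP.
have [|h|h] := irrX.2 _ _ (cl U) (cl V).
- move=> z _; apply: contrapT => /not_orP[/contrapT Uz /contrapT Vz].
  by apply: nUV; exists z.
- exact: h x I Ux.
- exact: h y I Vy.
Qed.

(** By irreducibility a nonempty invertibility locus of [s] would meet [V], where [s] is 0. So [s]
    is nowhere invertible, hence nilpotent, hence 0 by reducedness. *)
Lemma affine_zero U V (h : V `<=` U) (s : O U) :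
  affine U -> nonempty_open V -> res h s = 0 -> s = 0.
Proof.
move=> aU nV s0.
have [|n /redX //] := affine_nilpotent aU (s := s).
move=> x [W [hW [Wx iW]]].
have [y [Vy Wy]] := nonempty_meet nV (ex_intro _ x Wx).
apply: (inv_at_res0 (sch_local X) Vy s0).
by exists W, hW.
Qed.

Lemma affine_nonzero U (s : O U) : affine U -> s <> 0 -> nonempty_open (basicO s).
Proof.
move=> aU s0; apply: contrapT => ns; apply: s0.
have [x sx|n /redX //] := affine_nilpotent aU (s := s).
by apply: ns; exists x.
Qed.

Lemma basic_nonzero U (s : O U) x : inv_at s x -> s <> 0.
Proof. by move=> sx s0; move: sx; rewrite s0; exact: (@inv_at0 X (sch_local X) U x). Qed.

Lemma affine_domain U : affine U -> nonempty_open U -> prime_ideal [set s : O U | s = 0].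
Proof.
move=> aU [x0 Ux0]; split=> //= [a b -> ->|a b ->||a b ab0].
- exact: addr0.
- exact: mulr0.
- exact: (sch_local X).1 Ux0.
have [|b0] := pselect (b = 0); first by right.
left; have [x [V [h [Vx [t bt]]]]] := affine_nonzero aU b0.
apply: (affine_zero (h := h) aU); first by exists x.
by rewrite -[LHS]mulr1 -bt mulrA -rmorphM ab0 rmorph0 mul0r.
Qed.

End Integral.

(* [L] is the function field of [X], and [gm V] sends a section over [V] to its germ at
   the generic point. *)
Definition germ_maps (k : fieldType) (X : scheme k) (L : fieldType)
    (gm : forall V : opens X, nonempty_open V -> {rmorphism O V -> L}) : Prop :=
  [/\ forall (V W : opens X) (h : W `<=` V) (nV : nonempty_open V) (nW : nonempty_open W) (s : O V),
        gm W nW (res h s) = gm V nV s,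
      forall (V V' : opens X) (nV : nonempty_open V) (nV' : nonempty_open V') (s : O V) (s' : O V'),
        gm V nV s = gm V' nV' s' -> exists (W : opens X) (h : W `<=` V) (h' : W `<=` V'),
          nonempty_open W /\ res h s = res h' s' &
      forall x : L, exists (V : opens X) (nV : nonempty_open V) (s : O V), x = gm V nV s].

Lemma function_field (k : fieldType) (X : scheme k) : irreducible_set [set: X] -> reduced X ->
  exists (L : fieldType)
    (gm : forall V : opens X, nonempty_open V -> {rmorphism O V -> L}), germ_maps gm.
Proof.
move=> irrX redX; have [[x0 _] _] := irrX.
have [U [Ux0 aU]] := sch_affine x0.
have nU : nonempty_open U by exists x0.
have [L [q [qker qonto]]] := residue_field (affine_domain irrX redX aU nU).
have qinj (W : opens X) (h : W `<=` U) (a b : O U) :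
    nonempty_open W -> res h a = res h b -> a = b.
  move=> nW ab; apply/eqP; rewrite -subr_eq0; apply/eqP.
  by apply: (affine_zero irrX redX aU nW (h := h)); rewrite rmorphB ab subrr.
have qeq a b : q a = q b -> a = b.
  by move=> ab; apply/eqP; rewrite -subr_eq0; apply/eqP/qker; rewrite rmorphB ab subrr.
have qn0 a : q a <> 0 <-> a <> 0 by split=> + h; apply; exact/qker.
(* [L] is the fraction field of the single ring [O U]; the germ of [s] is [a / b] as soon as
   [s * b = a] on some nonempty open set inside [U]. *)
pose G (V : opens X) (s : O V) (x : L) := exists (W : opens X) (h : W `<=` V) (h' : W `<=` U) a b,
  [/\ nonempty_open W, q b <> 0, x = q a / q b & res h s * res h' b = res h' a].
(* Agreement on a nonempty open set suffices: for one section this gives uniqueness of the germ, for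
   a section and its restriction it gives compatibility. *)
have Geq (V V' : opens X) (s : O V) (s' : O V') x x' : G V s x -> G V' s' x' ->
    (exists (W : opens X) (h : W `<=` V) (h' : W `<=` V'),
          nonempty_open W /\ res h s = res h' s') -> x = x'.
  move=> [W [h [h' [a [b [nW b0 -> e]]]]]] [W1 [h1 [h1' [a1 [b1 [nW1 b10 -> e1]]]]]].
  move=> [W2 [h2 [h2' [nW2 e2]]]].
  pose T := meetO W2 (meetO W W1).
  have T2 : T `<=` W2 by exact: subIsetl.
  have TW : T `<=` W by move=> z [_ []].
  have T1 : T `<=` W1 by move=> z [_ []].
  have nT : nonempty_open T by do 2! apply: (nonempty_meet irrX) => //.
  have /eqP b0' := b0; have /eqP b10' := b10.
  apply/eqP; rewrite eqr_div // -!rmorphM; apply/eqP; congr (q _).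
  apply: (qinj T (subset_trans TW h') _ _ nT); rewrite !rmorphM.
  have ea := congr1 (res TW) e; have ea1 := congr1 (res T1) e1;
    have ee := congr1 (res T2) e2.
  rewrite !rmorphM !(res_comp _ _ (subset_trans TW h')) (res_comp _ _ (subset_trans TW h)) in ea.
  rewrite !rmorphM !(res_comp _ _ (subset_trans TW h')) (res_comp _ _ (subset_trans T1 h1)) in ea1.
  rewrite (res_comp _ _ (subset_trans TW h)) (res_comp _ _ (subset_trans T1 h1)) in ee.
  by rewrite -ea -ea1 ee; ring.
have Gex (V : opens X) (s : O V) : nonempty_open V -> exists x, G V s x.
  move=> nV; have [y [Vy Uy]] := nonempty_meet irrX nV nU.
  have [_ bas _ loc] := aU; have [g [gy gV]] := bas V y Vy Uy.
  have [n [a e]] := loc g (res gV s).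
  have g0 : q (g ^+ n) <> 0.
    by apply/qn0; apply: (@basic_nonzero _ X U _ y); exact: inv_atX.
  exists (q a / q (g ^+ n)), (basicO g), gV, (@basicO_sub X U g), a, (g ^+ n).
  by split=> //; [exists y | rewrite rmorphXn].
have GE (V : opens X) (s : O V) x x' : nonempty_open V -> G V s x -> G V s x' -> x = x'.
  move=> nV h h'; apply: (Geq _ _ _ _ _ _ h h').
  by exists V, (@subset_refl _ V), (@subset_refl _ V).
have common (V : opens X) (s s' : O V) x x' : G V s x -> G V s' x' ->
    exists (W : opens X) (h : W `<=` V) (h' : W `<=` U) a b a' b', [/\ nonempty_open W,
      q b <> 0 /\ q b' <> 0, x = q a / q b /\ x' = q a' / q b',
      res h s * res h' b = res h' a & res h s' * res h' b' = res h' a'].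
  move=> [W [h [h' [a [b [nW b0 -> e]]]]]] [W1 [h1 [h1' [a1 [b1 [nW1 b10 -> e1]]]]]].
  have TW : meetO W W1 `<=` W by exact: subIsetl.
  have T1 : meetO W W1 `<=` W1 by exact: subIsetr.
  exists (meetO W W1), (subset_trans TW h), (subset_trans TW h'), a, b, a1, b1.
  split=> //; first exact: (nonempty_meet irrX).
    by rewrite -!(res_comp h TW) -!(res_comp h' TW) -e rmorphM.
  have ea1 := congr1 (res T1) e1.
  rewrite !rmorphM !(res_comp _ _ (subset_trans TW h')) (res_comp _ _ (subset_trans TW h)) in ea1.
  by [].
have gmP (V : opens X) (nV : nonempty_open V) : exists g : {rmorphism O V -> L}, forall s, G V s (g s).
  apply: rmorph_of_rel.
  - by move=> s; exact: Gex.
  - by move=> s x x'; exact: GE.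
  - exists (meetO V U), (@subIsetl _ V U), (@subIsetr _ V U), 1, 1.
    rewrite !rmorph1 divr1 mulr1; split=> //; first exact: (nonempty_meet irrX).
    by apply/eqP; exact: oner_neq0.
  - move=> s s' x x' Gx Gx'.
    have [W [h [h' [a [b [a' [b' [nW [/eqP b0 /eqP b'0] [-> ->] e e']]]]]]]] := common _ _ _ _ _ Gx Gx'.
    exists W, h, h', (a * b' - a' * b), (b * b').
    rewrite !rmorphM !rmorphB !rmorphM -e -e'; split=> //.
    + by apply/eqP; rewrite mulf_neq0.
    + by field; rewrite b0 b'0.
    + ring.
  - move=> s s' x x' Gx Gx'.
    have [W [h [h' [a [b [a' [b' [nW [/eqP b0 /eqP b'0] [-> ->] e e']]]]]]]] := common _ _ _ _ _ Gx Gx'.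
    exists W, h, h', (a * a'), (b * b').
    rewrite !rmorphM -e -e'; split=> //.
    + by apply/eqP; rewrite mulf_neq0.
    + by field; rewrite b0 b'0.
    + ring.
pose gm (V : opens X) nV := projT1 (cid (gmP V nV)).
have gmG (V : opens X) nV s : G V s (gm V nV s) by rewrite /gm; case: cid.
exists L, gm; split.
- move=> V W h nV nW s; apply: (Geq _ _ _ _ _ _ (gmG _ _ _) (gmG _ _ _)).
  exists W, (@subset_refl _ W), h; split=> //; exact: res_id.
- move=> V V' nV nV' s s' e.
  have [W [h [h' [a [b [nW b0 xE eW]]]]]] := gmG V nV s.
  have [W1 [h1 [h1' [a1 [b1 [nW1 b10 x1E eW1]]]]]] := gmG V' nV' s'.
  have /eqP b0' := b0; have /eqP b10' := b10.
  move: e => /eqP; rewrite xE x1E eqr_div // -!rmorphM => /eqP e.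
  have {e}/qeq e := e.
  have bb : q (b * b1) <> 0 by rewrite rmorphM; apply/eqP; rewrite mulf_neq0.
  (* Equality of germs gives only an equality multiplied by [b * b1]; on [W2] this product is
     invertible and can be cancelled. *)
  have [y [W2 [h2 [W2y [t bt]]]]] := affine_nonzero redX aU ((qn0 _).1 bb).
  pose T := meetO W2 (meetO W W1).
  have T2 : T `<=` W2 by exact: subIsetl.
  have TW : T `<=` W by move=> z [_ []].
  have T1 : T `<=` W1 by move=> z [_ []].
  have nT : nonempty_open T.
    by apply: (nonempty_meet irrX) => //; [exists y | exact: (nonempty_meet irrX)].
  exists T, (subset_trans TW h), (subset_trans T1 h1); split=> //.
  have TU := subset_trans TW h'.
  have eb := congr1 (res T2) bt.
  have ea := congr1 (res TW) eW; have ea1 := congr1 (res T1) eW1.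
  rewrite !rmorphM !(res_comp _ _ TU) (res_comp _ _ (subset_trans TW h)) in ea.
  rewrite !rmorphM !(res_comp _ _ TU) (res_comp _ _ (subset_trans T1 h1)) in ea1.
  rewrite !rmorphM !(res_comp _ _ TU) rmorph1 in eb.
  have {}e := congr1 (res TU) e; rewrite !rmorphM -ea -ea1 in e.
  rewrite -[LHS]mulr1 -[RHS]mulr1 -eb.
  set x1 := res _ s in e *; set x2 := res _ s' in e *.
  set y1 := res _ b in e *; set y2 := res _ b1 in e *.
  rewrite (_ : x1 * _ = x1 * y1 * y2 * res T2 t); last by ring.
  by rewrite e; ring.
- move=> x; have [a [b [b0 ->]]] := qonto x.
  have [y [W [h [Wy [t bt]]]]] := affine_nonzero redX aU ((qn0 b).1 b0).
  have nW : nonempty_open W by exists y.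
  exists W, nW, (res h a * t).
  apply: (GE _ _ _ _ nW _ (gmG _ _ _)).
  exists W, (@subset_refl _ W), h, a, b; split=> //.
  by rewrite res_id -mulrA [t * _]mulrC bt mulr1.
Qed.

Section Germs.
Variables (k : fieldType) (X : scheme k).
Hypotheses (irrX : irreducible_set [set: X]) (redX : reduced X).
Variables (L : fieldType)
  (gm : forall V : opens X, nonempty_open V -> {rmorphism O V -> L}).
Hypothesis gmX : germ_maps gm.

Lemma germ_res (V W : opens X) (h : W `<=` V) (nV : nonempty_open V)
    (nW : nonempty_open W) (s : O V) : gm nW (res h s) = gm nV s.
Proof. by case: gmX => + _ _; apply. Qed.

Lemma germ_affine_inj (U : opens X) (nU : nonempty_open U) (s : O U) :
  affine U -> gm nU s = 0 -> s = 0.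
Proof.
move=> aU s0; have [_ eq _] := gmX.
have [|W [h [h' [nW]]]] := eq U U nU nU s 0; first by rewrite s0 rmorph0.
by rewrite [X in _ = X]rmorph0; exact: affine_zero.
Qed.

Lemma germ_neq0 (V : opens X) (nV : nonempty_open V) (s : O V) x :
  inv_at s x -> gm nV s <> 0.
Proof.
move=> [W [h [Wx [t st]]]] s0; have nW : nonempty_open W by exists x.
have := congr1 (gm nW) st; rewrite rmorphM (germ_res h nV) s0 mul0r rmorph1 => /esym/eqP.
by rewrite oner_eq0.
Qed.

Lemma affine_fraction (U V : opens X) (s : O V) x : affine U -> oset U x -> oset V x ->
  exists (g : O U) (gV : basicO g `<=` V) n (a : O U),
    inv_at g x /\ res gV s * res (@basicO_sub X U g) (g ^+ n) = res (@basicO_sub X U g) a.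
Proof.
move=> [_ bas _ loc] Ux Vx; have [g [gx gV]] := bas V x Vx Ux.
have [n [a e]] := loc g (res gV s); exists g, gV, n, a; split=> //.
by rewrite rmorphXn.
Qed.

Lemma germ_fraction (U V : opens X) (nU : nonempty_open U) (nV : nonempty_open V) (s : O V) :
  affine U -> exists (a b : O U), gm nU b <> 0 /\ gm nV s = gm nU a / gm nU b.
Proof.
move=> aU; have [x [Ux Vx]] := nonempty_meet irrX nU nV.
have [g [gV [n [a [gx e]]]]] := affine_fraction s aU Ux Vx.
have nW : nonempty_open (basicO g) by exists x.
have gn := inv_atX n gx.
exists a, (g ^+ n); split; first exact: germ_neq0 gn.
have /eqP g0 := germ_neq0 (nV := nU) gn.
have := congr1 (gm nW) e; rewrite rmorphM !(germ_res _ nU) (germ_res _ nV) => <-.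
by rewrite mulfK.
Qed.

Lemma germ_frac_onto (U : opens X) (nU : nonempty_open U) : affine U -> frac_onto (gm nU).
Proof.
move=> aU x; have [_ _ surj] := gmX; have [V [nV [s ->]]] := surj x.
by have [a [b [b0 e]]] := germ_fraction nU nV s aU; exists a, b.
Qed.

(** [L] is the direct limit of the rings [O V] over nonempty open [V], and this is its universal
    property. *)
Lemma germ_hom (M : fieldType)
    (t : forall V : opens X, nonempty_open V -> {rmorphism O V -> M}) :
  (forall (V W : opens X) (h : W `<=` V) (nV : nonempty_open V) (nW : nonempty_open W)
    (s : O V), t W nW (res h s) = t V nV s) ->
  exists g : {rmorphism L -> M}, forall (V : opens X) (nV : nonempty_open V) (s : O V),
    g (gm nV s) = t V nV s.
Proof.
move=> tres; have [_ eq surj] := gmX.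
pose G x y := exists (V : opens X) (nV : nonempty_open V) (s : O V),
  x = gm nV s /\ y = t V nV s.
have Gf x y y' : G x y -> G x y' -> y = y'.
  move=> [V [nV [s [-> ->]]]] [V' [nV' [s' [e ->]]]].
  have [W [h [h' [nW eW]]]] := eq _ _ _ _ _ _ e.
  by rewrite -(tres _ _ h nV nW) eW tres.
have both x x' y y' : G x y -> G x' y' -> exists (V : opens X) (nV : nonempty_open V)
    (s s' : O V), [/\ x = gm nV s, y = t V nV s, x' = gm nV s' & y' = t V nV s'].
  move=> [V [nV [s [-> ->]]]] [V' [nV' [s' [-> ->]]]].
  have nW := nonempty_meet irrX nV nV'.
  have h : meetO V V' `<=` V by exact: subIsetl.
  have h' : meetO V V' `<=` V' by exact: subIsetr.
  exists (meetO V V'), nW, (res h s), (res h' s').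
  by rewrite (germ_res _ nV) (germ_res _ nV') (tres _ _ _ nV) (tres _ _ _ nV').
have [||||| g gE] := @rmorph_of_rel L M G.
- by move=> x; have [V [nV [s ->]]] := surj x; exists (t V nV s), V, nV, s.
- exact: Gf.
- have [[x _] _] := irrX; have nX : nonempty_open (fullO X) by exists x.
  by exists (fullO X), nX, 1; rewrite !rmorph1.
- move=> x x' y y' Gx Gx'; have [V [nV [s [s' [-> -> -> ->]]]]] := both _ _ _ _ Gx Gx'.
  by exists V, nV, (s - s'); rewrite !rmorphB.
- move=> x x' y y' Gx Gx'; have [V [nV [s [s' [-> -> -> ->]]]]] := both _ _ _ _ Gx Gx'.
  by exists V, nV, (s * s'); rewrite !rmorphM.
by exists g => V nV s; apply: Gf (gE _) _; exists V, nV, s.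
Qed.

Lemma closure_point_irreducible (x : X) : irreducible_set (closure [set x]).
Proof.
have cx : closure [set x] x by exact: subset_closure.
split; first by exists x.
move=> A B cA cB h; have [Ax|Bx] := h x cx.
  by left; rewrite closureE => y; apply; split=> // _ ->.
by right; rewrite closureE => y; apply; split=> // _ ->.
Qed.

Lemma krull_dim_of_chain (U : opens X) d (Z : nat -> set (O U)) : affine U ->
  (forall i, (i <= d)%N -> prime_ideal (Z i)) ->
  (forall i, (i < d)%N -> Z i `<` Z i.+1) -> krull_dim_ge X d.
Proof.
move=> [pt bas _ _] pZ ltZ.
have /choice[x xP] (i : nat) : exists x : X, (i <= d)%N ->
    oset U x /\ Z i = [set s : O U | ~ inv_at s x].
  have [id|] := pselect (i <= d)%N; last by have [[x0 _] _] := irrX; exists x0.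
  by have [x [xP _]] := pt _ (pZ i id); exists x.
(* The index is reversed because larger primes correspond to smaller closures. *)
exists (fun i => closure [set x (d - i)%N]); split=> [i id|i id].
  by split; [exact: closed_closure | exact: closure_point_irreducible].
set j := (d - i.+1)%N; have dij : (d - i = j.+1)%N by rewrite subnSK.
have jd : (j < d)%N by rewrite -dij leq_subr.
have [Ux ZE] := xP _ (ltnW jd); have [Ux' ZE'] := xP _ jd.
rewrite dij; have [sub nsub] := ltZ j jd; split.
  suff xx : closure [set x j] (x j.+1).
    by rewrite {1}closureE => y; apply; split; [exact: closed_closure | move=> _ ->].
  move=> B; rewrite nbhsE => -[V [oV Vx] VB].
  have [s [sx sV]] := bas (Opens oV) _ Vx Ux'.
  exists (x j); split=> //; apply/VB/sV.
  apply: contrapT => ns.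
  by have : Z j.+1 s by [apply: sub; rewrite ZE]; rewrite ZE'; apply.
move=> h; apply: nsub => s; rewrite ZE' ZE => ns sx; apply: ns.
have cl : closure [set x j.+1] (x j) by apply/h/subset_closure.
have [|_ [-> //]] := cl [set y | inv_at s y].
rewrite nbhsE; exists [set y | inv_at s y] => //; split=> //; exact: open_inv_at.
Qed.

Lemma trdeg_function_field (K : fieldType) (iota : {rmorphism k -> K})
    (U : opens X) (nU : nonempty_open U) : dim_le_trdeg X iota -> affine U ->
  finitely_generated (scal U) ->
  forall d (y : 'I_d -> O U), Trdeg.alg_indep (gm nU \o scal U) (gm nU \o y) ->
    Trdeg.trdeg_ge iota d.
Proof.
move=> hdim aU fgU d y iy; apply: hdim.
have [|Z [_ pZ ltZ]] := prime_chain fgU (kernel_prime (gm nU)) _ iy; first by [].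
exact: krull_dim_of_chain aU pZ ltZ.
Qed.

End Germs.

(** * Rational points and base change *)

Section RationalPoints.
Variables (K : fieldType) (Y : scheme K).
Implicit Types U V W : opens Y.

Lemma scal_inv_at V (c : K) x : oset V x -> c <> 0 -> inv_at (scal V c) x.
Proof.
move=> Vx /eqP c0; exists V, (@subset_refl _ V); split=> //.
by exists (scal V c^-1); rewrite res_id -rmorphM divff // rmorph1.
Qed.

Lemma noninv_scal V (s : O V) (c c' : K) x : oset V x ->
  ~ inv_at (s - scal V c) x -> ~ inv_at (s - scal V c') x -> c = c'.
Proof.
move=> Vx nc nc'; apply: contrapT => cc'.
have nN : ~ inv_at (- (s - scal V c)) x by rewrite -mulN1r => /inv_atM[].
apply: (noninv_atD (sch_local Y) Vx nc' nN).
rewrite (_ : _ + _ = scal V (c - c')); last by rewrite rmorphB; ring.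
by apply: scal_inv_at => // /eqP; rewrite subr_eq0 => /eqP.
Qed.

(** Evaluation at a rational point as a homomorphism: it reduces the identification of [fK (x n)] to
    a comparison of homomorphisms into [K]. *)
Lemma value_hom (x : Y) V : rational_point x -> oset V x ->
  exists ev : {rmorphism O V -> K}, (forall c, ev (scal V c) = c) /\
    forall s c, ev s = c <-> ~ inv_at (s - scal V c) x.
Proof.
move=> ratx Vx; have nD := noninv_atD (sch_local Y) Vx.
have nM (s t : O V) : ~ inv_at t x -> ~ inv_at (s * t) x by move=> nt /inv_atM[].
have [||||| ev evP] := @rmorph_of_rel (O V) K (fun s c => ~ inv_at (s - scal V c) x).
- by move=> s; exact: ratx.
- by move=> s c c'; exact: noninv_scal.
- by rewrite rmorph1 subrr; exact: (inv_at0 (sch_local Y)).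
- move=> s s' c c' sc sc'.
  rewrite (_ : _ - _ = (s - scal V c) + (- 1) * (s' - scal V c'));
    last by rewrite rmorphB; ring.
  by apply: nD => //; exact: nM.
- move=> s s' c c' sc sc'.
  rewrite (_ : _ - _ = s' * (s - scal V c) + scal V c * (s' - scal V c'));
    last by rewrite rmorphM; ring.
  by apply: nD; exact: nM.
have evE s c : ev s = c <-> ~ inv_at (s - scal V c) x.
  by split=> [<- //|]; exact: noninv_scal (evP s).
exists ev; split=> // c; apply/evE; rewrite subrr; exact: (inv_at0 (sch_local Y)).
Qed.

(** Near [x] every section is a fraction [a / g ^+ n] with [a] and [g] in [O W], so its value is the
    quotient of the values under [chi]. *)
Lemma rational_of_hom (x : Y) W (chi : {rmorphism O W -> K}) : affine W -> oset W x ->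
  (forall c, chi (scal W c) = c) -> (forall s, chi s = 0 <-> ~ inv_at s x) ->
  rational_point x.
Proof.
move=> aW Wx chis ker V s Vx.
have [g [gV [n [a [gx e]]]]] := affine_fraction s aW Wx Vx.
have /eqP gn0 : chi (g ^+ n) <> 0 by move/ker; apply; exact: inv_atX.
exists (chi a / chi (g ^+ n)); set c := _ / _ => isc.
have : chi (a - scal W c * g ^+ n) = 0 by rewrite rmorphB rmorphM chis /c divfK // subrr.
move/ker; apply.
apply/(inv_at_res (@basicO_sub Y W g) _ gx); rewrite rmorphB rmorphM res_scal -e.
rewrite (_ : _ - _ = res gV (s - scal V c) * res (@basicO_sub Y W g) (g ^+ n)).
  apply/inv_atM; split; first exact/(inv_at_res gV _ gx).
  by apply/(inv_at_res (@basicO_sub Y W g) _ gx); exact: inv_atX.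
by rewrite rmorphB res_scal mulrBl.
Qed.

End RationalPoints.

Section Pull.
Variables (k k' : fieldType) (phi : {rmorphism k -> k'}) (X : scheme k') (Y : scheme k).
Variables (U : opens X) (g : mor phi Y U).

Lemma pre_sub (V V' : opens Y) : V' `<=` V -> pre g V' `<=` pre g V.
Proof. by move=> h x [Ux Vx]; split=> //; exact: h. Qed.

Lemma pull_inv (V : opens Y) (s : O V) x : oset U x -> inv_at s (g x) -> inv_at (pull g V s) x.
Proof.
move=> Ux [W [h [Wx iW]]]; exists (pre g W), (pre_sub h); split=> //.
rewrite -(pull_res h); exact: invertible_rmorph.
Qed.

End Pull.

Section BaseChange.
Variables (k K : fieldType) (iota : {rmorphism k -> K}) (X : scheme k) (XK : scheme K).
Hypotheses (irrX : irreducible_set [set: X]) (redX : reduced X).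
Variables (p : mor iota X (fullO XK)) (hp : is_base_change p).

Lemma base_change_scal (U : opens X) c :
  pull p U (scal U c) = scal (pre p U) (iota c).
Proof. exact: pull_scal. Qed.

(* Multiplication by a nonzero function on an affine open set of X is injective
   after base change, so a basic open set cannot avoid its nonvanishing locus. *)
Lemma preimage_dense (V : opens X) : nonempty_open V -> dense (pre p V).
Proof.
move=> nV B [b Bb] oB; have [U [Ub aU]] := sch_affine (p b).
have [aW tens] := hp aU; have [_ bas _ _] := aW.
have [h [hb hB]] := bas (Opens oB) b Bb (conj I Ub).
have nU : nonempty_open U by exists (p b).
have [y [Vy Uy]] := nonempty_meet irrX nV nU.
have [_ basU _ _] := aU; have [g [gy gV]] := basU V y Vy Uy.
apply: contrapT => nBV.
have [z|n] := affine_nilpotent aW (s := pull p U g * h).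
  move=> /inv_atM[gz hz]; apply: nBV; exists z; split; first exact: hB hz.
  split=> //; apply: gV; apply: pull_local gz; exact: inv_at_dom hz.
rewrite exprMn -rmorphXn => gh.
have [r [e [c [ie hE]]]] := tensor_basis (base_change_scal U) tens (h ^+ n).
(* Since [O U] is a domain, the [g ^+ n * e l] are still independent, and [gh] forces all
   coefficients of [h ^+ n] to vanish. *)
have c0 l : c l = 0.
  apply: (tens.2 _ (fun l => g ^+ n * e l) c) => [d|].
    under eq_bigr => i _ do rewrite mulrCA.
    rewrite -mulr_sumr; have [_ _ _ _ dom0] := affine_domain irrX redX aU nU.
    move/dom0 => -[/= g0|]; last exact: ie.
    by case: (@inv_at0 X (sch_local X) U y); rewrite -g0; exact: inv_atX.
  rewrite -[RHS]gh hE mulr_sumr; apply: eq_bigr => i _.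
  by rewrite rmorphM mulrA.
apply: (@inv_at0 XK (sch_local XK) (pre p U) b).
rewrite (_ : 0 = h ^+ n); first exact: inv_atX.
by rewrite hE big1 // => l _; rewrite c0 rmorph0 mulr0.
Qed.

End BaseChange.

Lemma closed_field_algebraic (k : closedFieldType) (L : fieldType)
    (j : {rmorphism k -> L}) (x : L) : alg_over j x -> exists c, x = j c.
Proof.
move=> [p p0]; have [r ->] := closed_field_poly_normal p.
rewrite -mul_polyC rmorphM /= evpC => /eqP; rewrite mulf_eq0 fmorph_eq0 lead_coef_eq0.
rewrite (negbTE p0) rmorph_prod /= prodf_seq_eq0 => /hasP[c _ /=].
by rewrite rmorphB /= evpX evpC subr_eq0 => /eqP ->; exists c.
Qed.

(** In the binomial expansion the term [u a ^+ n] has coefficient 1, so the products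
    [a ^+ i * b ^+ (n - i)] are dependent over [k]. Divided by [b ^+ n], the dependence is an
    equation for [a / b]. *)
Lemma tensor_nilpotent_algebraic (k L : fieldType) (K A C : comPzRingType)
    (alpha : {rmorphism k -> A}) (u : {rmorphism A -> C}) (v : {rmorphism K -> C})
    (q : {rmorphism A -> L}) (a b : A) (c : K) n :
  (1 : K) <> 0 -> is_tensor alpha u v -> (u a - v c * u b) ^+ n = 0 -> q b <> 0 ->
  alg_over (q \o alpha) (q a / q b).
Proof.
move=> K1 tens /eqP; rewrite addrC exprDn => /eqP nil /eqP qb.
pose e (i : 'I_n.+1) := a ^+ i * b ^+ (n - i).
pose w (i : 'I_n.+1) := (- c) ^+ (n - i) *+ 'C(n, i).
have nie : ~ lin_indep alpha e.
  move=> ie; apply: K1.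
  have := tens.2 _ e w ie _ ord_max; rewrite /w subnn expr0 binn; apply.
  rewrite -[RHS]nil; apply: eq_bigr => i _.
  rewrite /e /w rmorphM rmorphMn !rmorphXn rmorphN -mulNr exprMn mulrnAr; congr (_ *+ _);
    ring.
have {nie}[d [de [i di]]] : exists d : 'I_n.+1 -> k,
    \sum_(i < n.+1) alpha (d i) * e i = 0 /\ exists i, d i <> 0.
  apply: contrapT => H; apply: nie => d de i; apply: contrapT => di.
  by apply: H; exists d; split=> //; exists i.
exists (\poly_(i < n.+1) d (inord i)).
  apply/eqP => /polyP/(_ i); rewrite coef_poly ltn_ord inord_val coef0; exact: di.
rewrite poly_def rmorph_sum /=.
have := congr1 (fun z => q z / q b ^+ n) de;
  rewrite rmorph0 mul0r rmorph_sum mulr_suml => dq; rewrite -[RHS]dq.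
apply: eq_bigr => l _; rewrite -mul_polyC [LHS]rmorphM /= evpC rmorphXn /= evpX inord_val /=.
rewrite /e !rmorphM !rmorphXn /= -mulrA; congr (_ * _).
have -> : q b ^+ n = q b ^+ (n - l) * q b ^+ l by rewrite -exprD subnK // -ltnS.
by rewrite expr_div_n; field; rewrite !expf_neq0.
Qed.

(** * The generic orbit and the invariant functions *)

Lemma iter_rmorph (R : pzRingType) (g : {rmorphism R -> R}) n :
  exists h : {rmorphism R -> R}, forall x, h x = iter n g x.
Proof.
elim: n => [|n [h hE]]; first by exists idfun.
by exists (g \o h) => x; rewrite /= hE.
Qed.

Lemma ratmap_eq_refl (k : fieldType) (X : scheme k) (f : ratmap X) : ratmap_eq f f.
Proof.
exists (dom f); split=> //; first exact: dom_dense.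
by split=> // V s W' h h' _; rewrite (Prop_irrelevance h h').
Qed.

Section RationalSelfMap.
Variables (k : fieldType) (X : scheme k).
Hypotheses (irrX : irreducible_set [set: X]) (redX : reduced X).
Variables (L : fieldType)
  (gm : forall V : opens X, nonempty_open V -> {rmorphism O V -> L}).
Hypothesis gmX : germ_maps gm.
Variables (f : ratmap X) (domf : dominant f).

Lemma dominant_pre (V : opens X) : nonempty_open V -> nonempty_open (pre f V).
Proof.
by move=> nV; have [y [Vy [x dx fx]]] := domf nV (opensP V); exists x; split=> //;
  rewrite /= fx.
Qed.

Lemma germ_scal (V V' : opens X) (nV : nonempty_open V) (nV' : nonempty_open V') c :
  gm nV (scal V c) = gm nV' (scal V' c).
Proof.
have [x _] := nV; have nX : nonempty_open (fullO X) by exists x.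
rewrite -(res_scal (@subsetT _ V : V `<=` fullO X)) -(res_scal (@subsetT _ V' : V' `<=` fullO X)).
by rewrite !(germ_res gmX _ nX).
Qed.

Lemma pullback_endomorphism : exists phi : {rmorphism L -> L},
  forall (V : opens X) (nV : nonempty_open V) (s : O V),
    phi (gm nV s) = gm (dominant_pre nV) (pull f V s).
Proof.
apply: (germ_hom irrX gmX (t := fun V nV => gm (dominant_pre nV) \o pull f V)).
move=> V W h nV nW s /=; rewrite (pull_res h (pre_sub h)).
exact: germ_res.
Qed.

End RationalSelfMap.

Section BaseChangeMap.
Variables (k K : closedFieldType) (iota : {rmorphism k -> K}) (X : scheme k) (XK : scheme K).
Hypotheses (irrX : irreducible_set [set: X]) (redX : reduced X).
Variables (p : mor iota X (fullO XK)) (hp : is_base_change p).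
Variables (f : ratmap X) (domf : dominant f).
Variables (fK : ratmap XK) (hfK : is_base_change_map p f fK).
Variables (L : fieldType)
  (gm : forall V : opens X, nonempty_open V -> {rmorphism O V -> L}).
Hypothesis gmX : germ_maps gm.
Variables (phi : {rmorphism L -> L}).
Hypothesis phiE : forall (V : opens X) (nV : nonempty_open V) (s : O V),
  phi (gm nV s) = gm (dominant_pre domf nV) (pull f V s).
Variables (U : opens X) (nU : nonempty_open U) (aU : affine U).
Variables (sigma : {rmorphism L -> K}).
Hypothesis sigmaE : forall c, sigma (gm nU (scal U c)) = iota c.

Let j : {rmorphism k -> L} := gm nU \o scal U.

Let phij c : phi (j c) = j c.
Proof.
by rewrite /= phiE (pull_scal f) (germ_scal gmX (dominant_pre domf nU) nU).
Qed.

Lemma pre_base_change_map (V : opens X) : pre p (pre f V) `<=` pre fK (pre p V).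
Proof.
case: hfK => domE comm _ x [_ [dx fx]].
have dKx : oset (dom fK) x by rewrite domE.
by split=> //; split=> //; rewrite /= comm.
Qed.

(** Values are described over every nonempty [V], not only over [U], because [f] pulls functions on
    [U] back to [pre f U]. The uniqueness clause serves to recognize [fK (x n)] as [x n.+1]. *)
Lemma generic_orbit : exists x : nat -> XK,
  [/\ forall n (V : opens X), nonempty_open V -> oset V (p (x n)),
      forall n, rational_point (x n),
      forall n (V : opens X) (nV : nonempty_open V) (t : O V),
        ~ inv_at (pull p V t - scal (pre p V) (sigma (iter n phi (gm nV t)))) (x n),
      forall n y, oset (pre p U) y ->
        (forall (t : O (pre p U)), inv_at t y <-> inv_at t (x n)) -> y = x n &
      exists chi : nat -> {rmorphism O (pre p U) -> K}, forall n,
        [/\ forall a, chi n (pull p U a) = sigma (iter n phi (gm nU a)),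
            forall c, chi n (scal (pre p U) c) = c &
            forall s, chi n s = 0 <-> ~ inv_at s (x n)]].
Proof.
have [aW tens] := hp aU.
have /choice[chi chiP] n : exists chi : {rmorphism O (pre p U) -> K},
    (forall a, chi (pull p U a) = sigma (iter n phi (gm nU a))) /\
    (forall c, chi (scal (pre p U) c) = c).
  have [ph phE] := iter_rmorph phi n.
  have [|g [ga gc]] := tensor_lift (base_change_scal p U) tens
    (s := sigma \o (ph \o gm nU)) (t := idfun).
    move=> c /=; rewrite phE -sigmaE; congr (sigma _).
    by elim: n {ph phE} => //= n ->; exact: phij.
  by exists g; split=> // a; rewrite ga /= phE.
have [pt _ _ _] := aW.
have /choice[x xP] n : exists x, oset (pre p U) x /\
    [set s | chi n s = 0] = [set s | ~ inv_at s x].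
  by have [x [xP _]] := pt _ (kernel_prime (chi n)); exists x.
have xU n : oset (pre p U) (x n) by case: (xP n).
have ker n s : chi n s = 0 <-> ~ inv_at s (x n).
  by have [_ /(congr1 (fun S : set _ => S s)) /= <-] := xP n.
have val n (V : opens X) (nV : nonempty_open V) (t : O V) : oset V (p (x n)) ->
    ~ inv_at (pull p V t - scal (pre p V) (sigma (iter n phi (gm nV t)))) (x n).
  move=> Vx ti; have [_ Ux] := xU n.
  (* Near [p (x n)] the section [t] is [a / g ^+ m] with [a] and [g] in [O U], where [chi n] knows
     the values. *)
  have [g [gV [m [a [gx e]]]]] := affine_fraction t aU Ux Vx.
  set c := sigma _ in ti.
  have [ph phE] := iter_rmorph phi n.
  have : chi n (pull p U a - scal _ c * pull p U (g ^+ m)) = 0.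
    rewrite rmorphB rmorphM (chiP n).2 !(chiP n).1 /c -!phE -!rmorphM.
    have nD : nonempty_open (basicO g) by exists (p (x n)).
    have := congr1 (gm nD) e.
    rewrite rmorphM !(germ_res gmX _ nU) (germ_res gmX _ nV) => ->.
    by rewrite subrr.
  move/ker; apply.
  have Dx : oset (pre p (basicO g)) (x n) by [].
  have hU : pre p (basicO g) `<=` pre p U by exact: (pre_sub (@basicO_sub X U g)).
  have hV : pre p (basicO g) `<=` pre p V by exact: (pre_sub gV).
  apply/(inv_at_res hU _ Dx).
  rewrite rmorphB rmorphM res_scal -!(pull_res (@basicO_sub X U g) hU) -e rmorphM (pull_res gV hV).
  rewrite -(res_scal hV) -mulrBl -rmorphB; apply/inv_atM; split.
    exact/(inv_at_res hV _ Dx).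
  apply: pull_inv => //.
  by apply/(inv_at_res (@basicO_sub X U g) _ gx); exact: inv_atX.
have gen n (V : opens X) : nonempty_open V -> oset V (p (x n)).
  move=> nV; have [y [Vy Uy]] := nonempty_meet irrX nV nU.
  have [_ bas _ _] := aU; have [g [gy gV]] := bas V y Vy Uy.
  (* The germ of [g] is nonzero and field homomorphisms are injective, so [chi n] does not kill the
     pullback of [g]; hence [p (x n)] lies in [basicO g]. *)
  apply: gV; have [ph phE] := iter_rmorph phi n.
  apply: (pull_local (m := p)); first exact: xU.
  apply: contrapT => /ker; rewrite (chiP n).1 -phE => /eqP.
  by rewrite !fmorph_eq0 => /eqP; exact: germ_neq0 gy.
exists x; split=> //.
- move=> n; apply: (rational_of_hom aW (xU n) (chiP n).2); exact: ker.
- by move=> n V nV t; apply: val; exact: gen.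
- move=> n y Uy yx; have [z [_ zu]] := pt _ (kernel_prime (chi n)).
  transitivity z; last by apply: zu; exact: xP.
  apply/esym/zu; split=> //; apply/seteqP; split=> s /=; first by move/ker=> h /yx.
  by move=> h; apply/ker => /yx.
- by exists chi => n; have [h1 h2] := chiP n; split.
Qed.

Section GenericOrbit.
Variables (x : nat -> XK) (chi : nat -> {rmorphism O (pre p U) -> K}).
Hypothesis gen : forall n (V : opens X), nonempty_open V -> oset V (p (x n)).
Hypothesis ratx : forall n, rational_point (x n).
Hypothesis val : forall n (V : opens X) (nV : nonempty_open V) (t : O V),
  ~ inv_at (pull p V t - scal (pre p V) (sigma (iter n phi (gm nV t)))) (x n).
Hypothesis uniq : forall n y, oset (pre p U) y ->
  (forall (t : O (pre p U)), inv_at t y <-> inv_at t (x n)) -> y = x n.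
Hypothesis chiu : forall n a, chi n (pull p U a) = sigma (iter n phi (gm nU a)).
Hypothesis chic : forall n c, chi n (scal (pre p U) c) = c.
Hypothesis chi0 : forall n s, chi n s = 0 <-> ~ inv_at s (x n).

Lemma generic_pre n (V : opens X) : nonempty_open V -> oset (pre p V) (x n).
Proof. by move=> nV; split=> //; exact: gen. Qed.

Lemma nonempty_dom : nonempty_open (dom f).
Proof.
have [y _] := nU; have [z [_ dz]] := @dom_dense _ _ f _ (ex_intro _ y I) (@openT X).
by exists z.
Qed.

(** Pulling back by [fK] and evaluating at [x n] gives [chi n.+1]: on functions from [U] because
    [phi] is the action of [f], on [K] because [fK] lies over [K], and these generate. Locality of
    the pullback then shows that [fK (x n)] has the invertible sections of [x n.+1]. *)
Lemma generic_step n : fK (x n) = x n.+1.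
Proof.
have [domE _ comm] := hfK.
have nfU := dominant_pre domf nU.
have xpre : oset (pre fK (pre p U)) (x n).
  by apply: pre_base_change_map; exact: generic_pre.
have [dx fxU] := xpre.
apply: uniq => // t.
have [ev [evc evE]] := value_hom (@ratx n) xpre.
have evt s : ev (pull fK (pre p U) s) = chi n.+1 s.
  have [_ tens] := hp aU; have [r [a [b ->]]] := tens.1 s.
  rewrite !rmorph_sum; apply: eq_bigr => i _; rewrite !rmorphM chic chiu; congr (_ * _).
    apply/evE; rewrite iterSr phiE.
    have Wx : oset (meetO (pre fK (pre p U)) (pre p (pre f U))) (x n).
      by split=> //; exact: generic_pre.
    have h1 : meetO (pre fK (pre p U)) (pre p (pre f U)) `<=` pre fK (pre p U) by exact: subIsetl.
    have h2 : meetO (pre fK (pre p U)) (pre p (pre f U)) `<=` pre p (pre f U) by exact: subIsetr.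
    move/(inv_at_res h1 _ Wx); rewrite rmorphB comm res_scal -(res_scal h2) -rmorphB.
    by move/(inv_at_res h2 _ Wx); exact: val.
  by rewrite (pull_scal fK) evc.
have key s : inv_at s (fK (x n)) <-> inv_at (pull fK (pre p U) s) (x n).
  by split=> [|]; [exact: pull_inv | exact: pull_local].
have ev0 s : ev s = 0 <-> ~ inv_at s (x n).
  by have := evE s 0; rewrite rmorph0 subr0.
split=> [/key ti|ti]; [apply: contrapT => /chi0|apply/key; apply: contrapT => /ev0].
  by rewrite -evt => /ev0.
by rewrite evt => /chi0.
Qed.

Lemma generic_is_orbit : is_orbit fK (x 0%N) x.
Proof.
have [domE _ _] := hfK; split=> // n.
have dx : oset (dom fK) (x n) by rewrite domE; apply: generic_pre; exact: nonempty_dom.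
split; first by apply; exists fK; split=> //; exact: ratmap_eq_refl.
by exists fK; split=> //; [exact: ratmap_eq_refl | exact: generic_step].
Qed.

Lemma generic_orbit_dense : (forall y, phi y = y -> exists c, y = j c) -> dense (range x).
Proof.
move=> inv B B0 oB; have [aW tens] := hp aU.
(* Density of the preimage of [U] moves the test set into an affine open set, where it contains some
   [basicO h]; if the orbit misses it, every [chi n] kills [h]. *)
have [z [Bz Uz]] := preimage_dense irrX redX hp nU B0 oB.
have [_ bas _ _] := aW; have [h [hz hB]] := bas (Opens oB) z Bz Uz.
apply: contrapT => nx.
have h0 n : chi n h = 0.
  by apply/chi0 => hx; apply: nx; exists (x n); split; [exact: hB hx | exists n].
have [r [e [b [ie hE]]]] := tensor_basis (base_change_scal p U) tens h.
have ie' : lin_indep j (gm nU \o e).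
  by apply: (@lin_indep_map k L (O U) (scal U) (gm nU) r e _ ie) => s;
    exact: (germ_affine_inj irrX redX gmX).
have b0 := casorati_ext (sigma := sigma) phij inv (b := b) ie' _.
have {b0}b0 l : b l = 0.
  apply: b0 => n; rewrite -[RHS](h0 n) hE rmorph_sum; apply: eq_bigr => i _.
  by rewrite rmorphM chiu chic.
apply: (@inv_at0 XK (sch_local XK) (pre p U) z).
rewrite (_ : 0 = h) //.
by rewrite hE big1 // => l _; rewrite b0 rmorph0 mulr0.
Qed.

Lemma invariant_ratfun y : phi y = y -> (~ exists c, y = j c) ->
  exists a : ratfun XK, Defs.invariant fK a /\ ~ exists c : K, ratfun_eq a (ratfun_const XK c).
Proof.
move=> phiy ny; have [_ eq surj] := gmX; have [V [nV [s ys]]] := surj y.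
have [domE _ comm] := hfK.
exists (Ratfun (preimage_dense irrX redX hp nV) (pull p V s)); split.
  have sub := @pre_base_change_map V.
  have d : dense (pre fK (pre p V)).
    move=> B B0 oB.
    have [z [Bz pz]] := preimage_dense irrX redX hp (dominant_pre domf nV) B0 oB.
    by exists z; split=> //; exact: sub.
  exists d; rewrite ys phiE in phiy.
  have [W [h [h' [nW e]]]] := eq _ _ _ _ _ _ phiy.
  have h1 : pre p W `<=` pre p (pre f V) by exact: (pre_sub h).
  have h2 : pre p W `<=` pre p V by exact: (pre_sub h').
  exists (pre p W), (subset_trans h1 sub), h2; split;
    first exact: (preimage_dense irrX redX hp nW).
  by rewrite /= (comm _ _ _ _ h1) -(pull_res h h1) e (pull_res h' h2).
move=> [c [W [ha [hb [dW /= e]]]]].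
have [a [b [b0 sE]]] := germ_fraction irrX gmX nU nV s aU.
have [aW tens] := hp aU.
have nT0 := nonempty_meet irrX nV nU.
have tV : meetO V U `<=` V by exact: subIsetl.
have tU : meetO V U `<=` U by exact: subIsetr.
have [|T [h [h' [nT eT]]]] := eq _ _ nT0 nT0 (res tV s * res tU b) (res tU a).
  rewrite rmorphM (germ_res gmX _ nV) !(germ_res gmX _ nU) sE divfK //; exact/eqP.
rewrite rmorphM (res_comp _ _ (subset_trans h tV)) (res_comp _ _ (subset_trans h tU)) in eT.
rewrite (res_comp _ _ (subset_trans h tU)) in eT.
set hV := subset_trans h tV in eT; set hU := subset_trans h tU in eT.
have hV' : pre p T `<=` pre p V by exact: (pre_sub hV).
have hU' : pre p T `<=` pre p U by exact: (pre_sub hU).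
have {}eT := congr1 (pull p T) eT.
rewrite rmorphM (pull_res hV hV') !(pull_res hU hU') in eT.
(* Every nonempty open set meets the part of [W] lying over [T], where the pullback of [s] is both
   [a / b] and [c]; there [a - c * b] restricts to 0, so it is nowhere invertible. *)
have [z|n] := affine_nilpotent aW (s := pull p U a - scal (pre p U) c * pull p U b).
  move=> zi.
  have [z1 [z1i z1T]] := preimage_dense irrX redX hp nT (ex_intro _ z zi) (open_inv_at _).
  have oi := openI (open_inv_at (pull p U a - scal (pre p U) c * pull p U b)) (opensP (pre p T)).
  have [z2 [[z2i z2T] Wz2]] := dW _ (ex_intro _ z1 (conj z1i z1T)) oi.
  have m1 : meetO W (pre p T) `<=` W by exact: subIsetl.
  have m2 : meetO W (pre p T) `<=` pre p T by exact: subIsetr.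
  apply: (inv_at_res0 (sch_local XK) (h := subset_trans m2 hU') _ _ z2i); first by split.
  rewrite rmorphB rmorphM -!(res_comp hU' m2) -eT rmorphM.
  rewrite (res_comp hV' m2 (subset_trans m1 ha)) -(res_comp ha m1) e.
  by rewrite !res_scal subrr.
move=> nil; apply: ny; rewrite ys sE; apply: closed_field_algebraic.
apply: (tensor_nilpotent_algebraic _ tens nil b0).
by apply/eqP; exact: oner_neq0.
Qed.

End GenericOrbit.
End BaseChangeMap.

Theorem proposition1p7 (k : closedFieldType) (X : scheme k) (hX : is_variety X)
    (f : ratmap X) (hf : dominant f)
    (K : closedFieldType) (iota : {rmorphism k -> K})
    (hdim : dim_le_trdeg X iota)
    (XK : scheme K) (p : mor iota X (fullO XK)) (hp : is_base_change p)
    (fK : ratmap XK) (hfK : is_base_change_map p f fK) :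
  ZDO fK.
Proof.
have [irrX redX _ [m [cover [coverX affcover]]]] := hX.
have [L [gm gmX]] := function_field irrX redX.
have [[x0 _] _] := irrX; have [i Ux0] := coverX x0; have [aU fgU] := affcover i.
set U := cover i in Ux0 aU fgU; have nU : nonempty_open U by exists x0.
have [phi phiE] := pullback_endomorphism irrX gmX hf.
have [sigma sigmaE] := field_embedding (iota := iota) fgU (germ_frac_onto irrX gmX nU aU)
  (trdeg_function_field irrX hdim aU fgU).
have [x [gen ratx val uniq [chi chiP]]] :=
  generic_orbit irrX hp gmX phiE aU sigmaE.
have chiu n a : chi n (pull p U a) = sigma (iter n phi (gm U nU a)) by case: (chiP n).
have chic n c : chi n (scal (pre p U) c) = c by case: (chiP n).
have chi0 n s : chi n s = 0 <-> ~ inv_at s (x n) by case: (chiP n).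
have [[y [phiy ny]]|inv] := pselect (exists y, phi y = y /\
    ~ exists c, y = gm U nU (scal U c)).
  left; exact: (invariant_ratfun irrX redX hp hfK gmX phiE aU phiy ny).
right; exists (x 0%N), x; split; first exact: ratx.
  exact: (generic_is_orbit hp hfK phiE aU gen ratx val uniq chiu chic chi0).
apply: (generic_orbit_dense irrX redX hp gmX phiE aU chiu chic chi0) => y phiy.
by apply: contrapT => ny; apply: inv; exists y.
Qed.
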